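(* (i) Let $r,n$ be positive integers. Then $K_{r,n}=1$ if and only if a Hadamard matrix of order $n$ exists and $r\le\rho(n)$. Moreover, if $A$ is a sign form on $\ell_2^r\times\ell_2^n\times\ell_2^n$ with $\|A\|>\sqrt n$, then $$\frac{\|A\|}{\sqrt n}\ge\left(1+\frac{2}{n^3}\right)^{1/4}.$$ (ii) Let $0<\delta<2$, and let $(r_n)$ and $(m_n)$ be sequences of positive integers. If $1\le m_n\le n$ for all $n$ and $r_n\le(2-\delta)\log_2 n$ for all sufficiently large $n$, then $K(r_n,m_n,n)=1+o(1)$ as $n\to\infty$. (iii) There is a universal constant $c>0$ such that, for all positive integers $r,n$ with $r\ge 2\lceil\log_2(8n)\rceil$, one has $$K_{r,n}\ge 1+\frac{c}{(1+\log_2 n)^4}.$$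
   Context: Here $\ell_2^d$ is $\mathbb{R}^d$ with the Euclidean norm $\|\cdot\|_2$. A (trilinear) sign form on $\ell_2^r\times\ell_2^m\times\ell_2^n$ is a real trilinear form $A(x,y,z)=\sum_{i=1}^r\sum_{j=1}^m\sum_{k=1}^n\varepsilon_{ijk}x_iy_jz_k$ with all $\varepsilon_{ijk}\in\{-1,1\}$; its norm is $\|A\|=\sup\{|A(x,y,z)|:\|x\|_2,\|y\|_2,\|z\|_2\le1\}$. For $1\le m\le n$, $\Lambda(r,m,n)$ is the minimum of $\|A\|$ over all sign forms $A$ on $\ell_2^r\times\ell_2^m\times\ell_2^n$; $K(r,m,n):=\Lambda(r,m,n)/\sqrt n$ and $K_{r,n}:=K(r,n,n)$. A Hadamard matrix of order $n$ is $H\in\{-1,1\}^{n\times n}$ with $HH^T=nI_n$. The Hurwitz--Radon function $\rho$ is defined by writing uniquely $n=2^{4a+b}u$ with $u$ odd, $a\ge0$ an integer, $0\le b\le3$, and setting $\rho(n)=8a+2^b$. Asymptotic statements involving $\log_2 n$ are understood for integers $n\ge2$. *)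

(* Defs.v *)
From HB Require Import structures.
From mathcomp Require Import all_boot all_order all_algebra.
From mathcomp Require Import all_classical all_reals all_analysis.
Import Order.TTheory GRing.Theory Num.Theory.
Import numFieldNormedType.Exports.

Set Implicit Arguments.
Unset Strict Implicit.
Unset Printing Implicit Defensive.

Local Open Scope classical_set_scope.
Local Open Scope ring_scope.

(* The norm that MathComp-Analysis puts on row vectors is the max norm, so the
   Euclidean norm of l_2^d is defined here. *)
Definition enorm (R : realType) (d : nat) (x : 'rV[R]_d) : R :=
  Num.sqrt (\sum_(i < d) x 0 i ^+ 2).

Definition triform (R : realType) (r m n : nat)
    (e : 'I_r -> 'I_m -> 'I_n -> R)
    (x : 'rV[R]_r) (y : 'rV[R]_m) (z : 'rV[R]_n) : R :=
  \sum_(i < r) \sum_(j < m) \sum_(k < n) e i j k * x 0 i * y 0 j * z 0 k.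

Definition sign_form (R : realType) (r m n : nat)
    (A : 'rV[R]_r -> 'rV[R]_m -> 'rV[R]_n -> R) : Prop :=
  exists e : 'I_r -> 'I_m -> 'I_n -> R,
    (forall i j k, e i j k = 1 \/ e i j k = -1) /\ A = triform e.

(* For a trilinear A this set is nonempty and bounded, so that sup is the
   genuine supremum. *)
Definition form_norm (R : realType) (r m n : nat)
    (A : 'rV[R]_r -> 'rV[R]_m -> 'rV[R]_n -> R) : R :=
  sup [set t : R | exists x y z,
    [/\ enorm x <= 1, enorm y <= 1, enorm z <= 1 & t = `|A x y z|]].

(* The infimum is a minimum, since there are finitely many sign forms: see
   [Lambda_min]. *)
Definition Lambda (R : realType) (r m n : nat) : R :=
  inf [set form_norm A | A in @sign_form R r m n].

Definition K (R : realType) (r m n : nat) : R :=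
  Lambda R r m n / Num.sqrt n%:R.

Definition log2 (R : realType) (x : R) : R := ln x / ln 2.

Definition is_hadamard (n : nat) (H : 'M[int]_n) : Prop :=
  (forall i j, H i j = 1 \/ H i j = -1) /\ H *m H^T = n%:R%:M.

(* [logn 2 n] is the exponent 4 * a + b of 2 in n: see [hurwitz_radonE]. *)
Definition hurwitz_radon (n : nat) : nat :=
  (8 * (logn 2 n %/ 4) + 2 ^ (logn 2 n %% 4))%N.

Lemma hurwitz_radonE (a b u : nat) : odd u -> (b <= 3)%N ->
  hurwitz_radon (2 ^ (4 * a + b) * u)%N = (8 * a + 2 ^ b)%N.
Proof.
move=> u_odd b3.
have lg : logn 2 (2 ^ (4 * a + b) * u)%N = (4 * a + b)%N.
  have u0 : (0 < u)%N by exact: odd_gt0.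
  have p0 : (0 < 2 ^ (4 * a + b))%N by rewrite expn_gt0.
  rewrite (lognM 2 p0 u0) (pfactorK _ (isT : prime 2)).
  by rewrite logn_coprime ?addn0 // coprime2n.
by rewrite /hurwitz_radon lg (mulnC 4 a) divnMDl // modnMDl divn_small // modn_small // addn0.
Qed.

Lemma Lambda_min (R : realType) (r m n : nat) :
  (exists A, @sign_form R r m n A /\ form_norm A = Lambda R r m n) /\
  (forall A, @sign_form R r m n A -> Lambda R r m n <= form_norm A).
Proof.
pose g (s : {ffun 'I_r * 'I_m * 'I_n -> bool}) :=
  triform (fun i j k => (-1) ^+ s (i, j, k) : R).
pose f s := form_norm (g s).
have gS s : sign_form (g s).
  exists (fun i j k => (-1) ^+ s (i, j, k)); split=> // i j k.
  by case: (s _); [right; exact: expr1 | left; exact: expr0].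
have Sg A : sign_form A -> exists s, A = g s.
  move=> [e [e1 ->]].
  exists [ffun p => e p.1.1 p.1.2 p.2 == -1].
  congr triform; apply/funext => i; apply/funext => j; apply/funext => k.
  rewrite ffunE /=; case: (e1 i j k) => ->; last by rewrite eqxx.
  by rewrite -subr_eq0 opprK -(natrD _ 1 1) pnatr_eq0.
have [s0 s0P] : exists s0, forall s, f s0 <= f s.
  exists [arg min_(s < [ffun=> false]) f s]%O => s.
  by case: Order.TotalTheory.arg_minP => // t _; apply.
have lb : lbound [set form_norm A | A in @sign_form R r m n] (f s0).
  by move=> _ [A /Sg[s ->] <-]; exact: s0P.
have mem : [set form_norm A | A in @sign_form R r m n] (f s0).
  by exists (g s0).
have -> : Lambda R r m n = f s0.
  apply/eqP; rewrite eq_le; apply/andP; split.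
    by apply: ge_inf mem; exists (f s0).
  by apply: lb_le_inf lb; exists (f s0).
by split=> [|A AS]; [exists (g s0) | apply: lb; exists A].
Qed.

(* Main.v *)
Require Import Defs.
From HB Require Import structures.
From mathcomp Require Import all_boot all_order all_algebra.
From mathcomp Require Import mxtens.
From mathcomp Require Import all_classical all_reals all_analysis.
From mathcomp Require Import zify ring lra.
Import Order.TTheory GRing.Theory Num.Theory.
Import numFieldNormedType.Exports.

Set Implicit Arguments.
Unset Strict Implicit.
Unset Printing Implicit Defensive.

Local Open Scope classical_set_scope.
Local Open Scope ring_scope.

(** Let M_x be the matrix of the bilinear form A(x, -, -), a linear combination
of the slices E_i of A. The norm of A is the largest operator norm of M_x for unit
vectors x, and one row of one slice already gives the bound sqrt(n).

Extremal forms. Suppose that the squared norm nu is close to n. Testing M_x on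
combinations of at most two basis vectors bounds the off-diagonal entries of
E_i E_i^T and all entries of E_i E_j^T + E_j E_i^T by multiples of nu - n. These
entries are integers, so they vanish when nu < n + 1/2 ([small_norm_relations]).
This gives at once the gap above sqrt(n) ([form_norm_gap]) and, at sqrt(n), the
Hurwitz-Radon relations: the slices are Hadamard matrices and the matrices
E_i E_0^T / n are anticommuting complex structures. The Hurwitz-Radon bound on
their number comes from two moves on Clifford systems: exchanging four squares of
one sign for four of the other ([clifford_flip4]), and splitting off a pair of
opposite squares while halving the dimension ([clifford_halve]). Read backwards,
with matrices that preserve sign vectors, the same moves build families P_i of
the maximal size ([hurwitz_radon_family]), and the slices P_i H for a Hadamard
matrix H give a form of norm sqrt(n).

Short forms. Tensor products of Hadamard matrices of orders 2 and 12 exist in all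
orders N = 2^a 12^b. As log 12 / log 2 is irrational, such orders occur just
above every large n, within any prescribed ratio and with b bounded
([near_orders]). Then the Hurwitz-Radon number of N is at least
2 log2 N - O(1), and truncating an extremal form of order N proves that K tends
to 1.

Long forms. Let kappa = 1 - n/nu. Since contractions N satisfy
||1 - N N^T||^2 <= tr(1 - N N^T) in the Hilbert-Schmidt norm ([gram_defect]), the
normalized slices satisfy the Hurwitz-Radon relations up to an error
O(sqrt(kappa n)). Tensoring their symmetric dilations with an exact Clifford
system of s = 2 k letters in order 2^(k+1) produces nearly commuting near
involutions, and the average W of their products is nearly a projection. Its trace
is 4 n / 2^k <= 1/2, while projections of trace below 1 vanish. The quantitative
form of this contradiction is |<W W, W>| <= ||W||^3 ([frob_cube],
[stability_bound]). Reordering words of length O(s) takes O(s^2) exchanges, hence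
the contradiction persists unless sqrt(kappa) is at least of order s^(-2): this is
the exponent 4 in the lower bound. *)

(** * Clifford systems in a ring *)

(** The signs [sg] record the squares: an element labelled [b] squares to (-1)^b.
Keeping the labels in a list, rather than counting the two kinds, makes each
construction below act on the head of the list, with [clifford_perm] to bring
the wanted elements there. The predicate [G] carries along what the elements
must satisfy besides the relations. *)
Definition clifford (A : pzRingType) (G : A -> Prop) (sg : seq bool) : Prop :=
  exists es : seq (bool * A),
    [/\ [seq e.1 | e <- es] = sg,
        (forall e, e \in es -> G e.2),
        all (fun e : bool * A => e.2 * e.2 == (-1) ^+ e.1) es &
        pairwise (fun e d : bool * A => e.2 * d.2 == - (d.2 * e.2)) es].

Lemma pairwise_perm (T : eqType) (r : rel T) (s t : seq T) :
  symmetric r -> perm_eq s t -> pairwise r s -> pairwise r t.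
Proof.
move=> rS; elim: s t => [|x s IHs] t.
  by move=> /perm_size/esym/size0nil->.
move=> st; have xt : x \in t by rewrite -(perm_mem st) mem_head.
case/splitPr: xt st => t1 t2.
rewrite -[_ ++ _ :: _]/(t1 ++ [:: x] ++ t2) perm_sym perm_catCA perm_cons perm_sym.
move=> st; rewrite pairwise_cons => /andP[xs /(IHs _ st)].
have : all (r x) (t1 ++ t2) by rewrite -(perm_all _ st).
rewrite all_cat !pairwise_cat allrel_consr /= => /andP[x1 x2] /and3P[r12 p1 p2].
rewrite allrel1l p1 p2 x2 r12 /= !andbT; apply/allP => y /(allP x1).
by rewrite rS.
Qed.

Lemma clifford_perm (A : pzRingType) (G : A -> Prop) (s t : seq bool) :
  perm_eq t s -> clifford G s -> clifford G t.
Proof.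
move=> + [es [sE GE sqE pE]]; rewrite -{}sE => st.
have e0 : bool * A := (false, 0).
have [Is] := perm_iotaP false st.
rewrite size_map => pIs tE.
have esE : perm_eq es [seq nth e0 es i | i <- Is].
  by rewrite perm_sym -[X in perm_eq _ X](mkseq_nth e0) perm_map.
exists [seq nth e0 es i | i <- Is]; split.
- rewrite tE -map_comp; apply/eq_in_map => i.
  rewrite (perm_mem pIs) mem_iota /= => ilt.
  by rewrite (nth_map e0).
- by move=> e; rewrite -(perm_mem esE); apply: GE.
- by rewrite -(perm_all _ esE).
apply: (pairwise_perm _ esE) => // x y.
by rewrite eq_sym eqr_oppLR eq_sym.
Qed.

Lemma clifford_behead (A : pzRingType) (G : A -> Prop) (b : bool) (s : seq bool) :
  clifford G (b :: s) -> clifford G s.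
Proof.
case=> [[|e es] [//= [_ sE] GE /andP[_ sq] /andP[_ pw]]].
by exists es; split=> // d des; apply: GE; rewrite inE des orbT.
Qed.

Section Anti.
Variable A : pzRingType.
Implicit Types a b c x y : A.

Definition anti a b := a * b = - (b * a).

Lemma antiP a b : reflect (anti a b) (a * b == - (b * a)).
Proof. exact: eqP. Qed.

Lemma antiC a b : anti a b -> anti b a.
Proof. by rewrite /anti => ->; rewrite opprK. Qed.

Lemma anti_mul a b c : anti a b -> anti a c -> GRing.comm a (b * c).
Proof.
rewrite /anti /GRing.comm => ab ac.
by rewrite mulrA ab mulNr -[b * a * c]mulrA ac mulrN opprK mulrA.
Qed.

Lemma comm_anti a b c : GRing.comm a b -> anti a c -> anti a (b * c).
Proof. by rewrite /anti /GRing.comm => ab ac; rewrite mulrA ab -[b * a * c]mulrA ac mulrN mulrA. Qed.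

Lemma anti_comm a b c : anti a b -> GRing.comm a c -> anti a (b * c).
Proof. by rewrite /anti /GRing.comm => ab ac; rewrite mulrA ab mulNr -[b * a * c]mulrA ac mulrA. Qed.

Lemma anti_sq a b : anti a b -> (a * b) * (a * b) = - (a * a) * (b * b).
Proof. by move=> ab; rewrite -mulrA (mulrA b) (antiC ab) !mulNr mulrN !mulrA. Qed.

Lemma comm_sq a b : GRing.comm a b -> (a * b) * (a * b) = (a * a) * (b * b).
Proof. by move=> ab; rewrite -mulrA (mulrA b) -ab !mulrA. Qed.

Lemma anti_mulr x y w :
  w * w = 1 -> anti x y -> anti x w -> anti y w -> anti (x * w) (y * w).
Proof.
move=> w1 xy xw yw; rewrite /anti.
rewrite -!mulrA (mulrA w) (mulrA w x) (antiC yw) (antiC xw).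
by rewrite !mulNr !mulrN -!mulrA w1 !mulr1 xy.
Qed.

Lemma sqr_signr (b : bool) : (-1) ^+ b * (-1) ^+ b = 1 :> A.
Proof. by case: b; rewrite ?expr1 ?expr0 ?mulrNN ?mulr1. Qed.

Lemma sq_prod4 (b : bool) x0 x1 x2 x3 :
  x0 * x0 = (-1) ^+ b -> x1 * x1 = (-1) ^+ b ->
  x2 * x2 = (-1) ^+ b -> x3 * x3 = (-1) ^+ b ->
  anti x0 x1 -> anti x0 x2 -> anti x0 x3 ->
  anti x1 x2 -> anti x1 x3 -> anti x2 x3 ->
  (x0 * (x1 * (x2 * x3))) * (x0 * (x1 * (x2 * x3))) = 1.
Proof.
move=> s0 s1 s2 s3 a01 a02 a03 a12 a13 a23.
rewrite anti_sq; last exact: (anti_comm a01 (anti_mul a02 a03)).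
rewrite comm_sq; last exact: anti_mul.
by rewrite anti_sq // s0 s1 s2 s3 !(mulNr, mulrN) opprK sqr_signr mulr1 sqr_signr.
Qed.
End Anti.

(** This is the isomorphism that exchanges four squares +1 with four squares -1,
the source of Bott periodicity: the product w of the four elements squares to 1,
anticommutes with each of the four and commutes with all other elements of the
system, so multiplying the four by w flips exactly their squares. *)
Lemma clifford_flip4 (A : pzRingType) (G : A -> Prop) (b : bool) (s : seq bool) :
  (forall x y, G x -> G y -> G (x * y)) ->
  clifford G [:: b, b, b, b & s] -> clifford G [:: ~~ b, ~~ b, ~~ b, ~~ b & s].
Proof.
move=> GM [[|[b0 x0] [|[b1 x1] [|[b2 x2] [|[b3 x3] es]]]]] [] //=.
case=> -> -> -> -> <- GE.
case/and5P=> /eqP s0 /eqP s1 /eqP s2 /eqP s3 sqE.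
case/and5P=> /and4P[/eqP a01 /eqP a02 /eqP a03 h0] /and3P[/eqP a12 /eqP a13 h1].
case/andP=> /eqP a23 h2 h3 pw.
pose w := x0 * (x1 * (x2 * x3)).
have w1 : w * w = 1 by apply: (@sq_prod4 _ b).
have c1 : GRing.comm x0 (x2 * x3) by apply: anti_mul.
have w0 : anti x0 w.
  by apply: comm_anti => //; apply: anti_comm.
have wx1 : anti x1 w.
  apply: anti_comm; first exact: antiC.
  by apply: GRing.commrM => //; apply: anti_mul.
have wx2 : anti x2 w.
  apply: anti_comm; first exact: antiC.
  apply: anti_mul; first exact: antiC.
  by apply: comm_anti.
have wx3 : anti x3 w.
  apply: anti_comm; first exact: antiC.
  apply: anti_mul; first exact: antiC.
  by apply: anti_comm => //; apply: antiC.
have sqf x : x * x = (-1) ^+ b -> anti x w -> (x * w) * (x * w) == (-1) ^+ (~~ b).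
  move=> sx xw; rewrite anti_sq // w1 mulr1 sx.
  by case: (b); rewrite /= ?expr1 ?expr0 ?opprK.
have antiw d : anti x0 d -> anti x1 d -> anti x2 d -> anti x3 d -> GRing.comm d w.
  move=> /antiC d0 /antiC d1 /antiC d2 /antiC d3.
  by apply: anti_mul => //; apply: anti_comm => //; apply: anti_mul.
have alld (x : A) : all (fun d => x * d.2 == - (d.2 * x)) es ->
   all (fun d : bool * A => x * w * d.2 == - (d.2 * (x * w))) es.
  move=> xE; apply/allP => d des.
  have a (y : A) : all (fun d => y * d.2 == - (d.2 * y)) es -> anti y d.2.
    by move=> /allP/(_ _ des)/eqP.
  have dw : GRing.comm d.2 w by apply: antiw; apply: a.
  by apply/eqP; apply: antiC; apply: anti_comm => //; apply: antiC; apply: a.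
have Gx x c : (c, x) \in [:: (b, x0), (b, x1), (b, x2), (b, x3) & es] -> G x.
  by move=> xin; apply: (GE (c, x)).
have G0 : G x0 by apply: (Gx x0 b); rewrite !inE eqxx ?orbT.
have G1 : G x1 by apply: (Gx x1 b); rewrite !inE eqxx ?orbT.
have G2 : G x2 by apply: (Gx x2 b); rewrite !inE eqxx ?orbT.
have G3 : G x3 by apply: (Gx x3 b); rewrite !inE eqxx ?orbT.
have Gw : G w by do 3?apply: (GM) => //.
exists [:: (~~ b, x0 * w), (~~ b, x1 * w), (~~ b, x2 * w), (~~ b, x3 * w) & es].
split=> //=.
- move=> e; rewrite !inE => /or4P[/eqP->|/eqP->|/eqP->|/orP[/eqP->|ein]] /=; do ?exact: GM.
  by apply: GE; rewrite !inE ein !orbT.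
- by rewrite !sqf.
rewrite !alld // pw !andbT.
by do !(apply/andP; split=> //); exact/eqP/anti_mulr.
Qed.

(** * Divisibility of the order by powers of 2 *)

(** If J anticommutes with the involution T, it exchanges the eigenspaces of T,
which therefore both have half the dimension. The map phi restricts to the
eigenspace of 1 the matrices that commute with T: it sends X to B X Q, where the
rows of B are a basis of the eigenspace and Q is a right inverse of B. *)
Lemma involution_restrict (F : numFieldType) (n : nat) (b : bool) (T J : 'M[F]_n) :
  T * T = 1 -> J * J = (-1) ^+ b -> anti J T ->
  exists (m : nat) (phi : 'M[F]_n -> 'M[F]_m),
    [/\ n = m.*2, phi 1 = 1, (forall X, phi (- X) = - phi X) &
        forall X Y, GRing.comm X T -> GRing.comm Y T -> phi (X * Y) = phi X * phi Y].
Proof.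
move=> T1 J1 JT.
pose P : 'M[F]_n := 1 + T; pose N : 'M[F]_n := 1 - T.
have [B [Q [BP BQ QB]]] : exists (B : 'M[F]_(\rank P, n)) (Q : 'M[F]_(n, \rank P)),
    [/\ (B :=: P)%MS, B *m Q = 1%:M &
        forall A : 'M[_]_(\rank P, n), (A <= B)%MS -> A *m Q *m B = A].
  exists (row_base P), (pinvmx (row_base P)); split; first exact: eq_row_base.
    by apply: mulmxVp; exact: row_base_free.
  by move=> A; exact: mulmxKpV.
exists (\rank P), (fun X => B *m X *m Q).
have PN : P *m N = 0.
  rewrite -[_ *m _]/(P * N) /P /N mulrDl mul1r mulrBr mulr1 T1.
  by rewrite subrKA subrr.
have Ju : J \in unitmx.
  have : J *m (J * (-1) ^+ b) = 1%:M.
    rewrite -[_ *m _]/(J * _) mulrA J1.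
    exact: sqr_signr.
  by move=> /mulmx1_unit[].
have rPN : \rank P = \rank N.
  have JP : J *m P = N *m J.
    rewrite -[LHS]/(J * P) -[RHS]/(N * J) /P /N mulrDr mulr1 mulrBl mul1r JT.
    by [].
  rewrite -(mxrankMfree N (_ : row_free J)) ?row_free_unit // -JP.
  by rewrite eqmxMfull // row_full_unit.
have stab X : GRing.comm X T -> (B *m X <= B)%MS.
  move=> XT; rewrite (eqmxMr _ BP) BP.
  have -> : P *m X = X *m P.
    by rewrite -[LHS]/(P * X) -[RHS]/(X * P) /P mulrDl mulrDr mul1r mulr1 XT.
  exact: submxMl.
split.
- apply/eqP; rewrite -addnn eqn_leq; apply/andP; split.
    have rn : \rank (P + N)%R = n.
      have -> : P + N = 2%:R%:M.
        by rewrite /P /N addrACA subrr addr0 -[LHS]/(1%:M + 1%:M) -raddfD.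
      by rewrite -scalemx1 mxrank_scale_nz ?mxrank1 // pnatr_eq0.
    by rewrite -[X in (X <= _)%N]rn {2}rPN; exact: mxrank_add.
  by rewrite {2}rPN; exact: mulmx0_rank_max.
- by rewrite -[1]/(1%:M) mulmx1.
- by move=> X; rewrite mulmxN mulNmx.
move=> X Y XT YT.
rewrite -[RHS]/(_ *m _) -[X * Y]/(X *m Y) !mulmxA.
by rewrite QB // stab.
Qed.

Definition has_clifford (F : pzRingType) (n : nat) := @clifford 'M[F]_n (fun=> True).

(** For x0 of square 1 and x1 of square -1, the product x0 x1 is an involution
that anticommutes with x1 and commutes with the rest of the system. *)
Lemma clifford_halve (F : numFieldType) (n : nat) (s : seq bool) :
  has_clifford F n [:: false, true & s] ->
  exists2 m, n = m.*2 & has_clifford F m s.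
Proof.
case=> [[|[b0 x0] [|[b1 x1] es]]] [] //=.
case=> -> -> <- _ /and3P[/eqP s0 /eqP s1 sq] /andP[/andP[/eqP a01 h0] /andP[h1 pw]].
have T1 : (x0 * x1) * (x0 * x1) = 1.
  by rewrite (anti_sq a01) s0 s1 /= expr0 expr1 mulNr mul1r opprK.
have JT : anti x1 (x0 * x1) by apply: anti_comm => //; exact: antiC.
have [m [phi [nm p1 pN pM]]] := involution_restrict (b := true) T1 s1 JT.
have cm d : d \in es -> GRing.comm d.2 (x0 * x1).
  by move=> din; apply: anti_mul; apply: antiC; apply/eqP;
    [exact: (allP h0) | exact: (allP h1)].
exists m => //; exists [seq (e.1, phi e.2) | e <- es]; split=> //.
- by rewrite -map_comp; apply: eq_map.
- rewrite all_map; apply/allP => d din /=.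
  have dd : d.2 * d.2 = (-1) ^+ d.1 by apply/eqP; exact: (allP sq _ din).
  have cc := cm _ din; rewrite -(pM _ _ cc cc) dd.
  by case: d.1; rewrite ?expr1 ?expr0 ?pN ?p1.
rewrite pairwise_map; apply/(pairwiseP (false, 0)) => i j ii jj ij /=.
have dn k : k \in gtn (size es) -> nth (false, 0) es k \in es by apply: mem_nth.
have ci := cm _ (dn _ ii); have cj := cm _ (dn _ jj).
have aij : anti (nth (false, 0) es i).2 (nth (false, 0) es j).2.
  by apply/eqP; exact: (pairwiseP _ pw _ _ ii jj ij).
by rewrite -(pM _ _ ci cj) -(pM _ _ cj ci) aij pN.
Qed.

Lemma anti_add (A : pzRingType) (x y z : A) : anti x y -> anti x z -> anti x (y + z).
Proof. by rewrite /anti => xy xz; rewrite mulrDr mulrDl xy xz opprD. Qed.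

Lemma anti_sqD (A : pzRingType) (x y : A) :
  anti x y -> (x + y) * (x + y) = x * x + y * y.
Proof. by rewrite /anti => xy; rewrite mulrDl !mulrDr xy addrA subrK. Qed.

(** A complex structure e has det(e)^2 = det(-1) = (-1)^n. *)
Lemma clifford1_dvd (F : realFieldType) (n : nat) :
  has_clifford F n [:: true] -> (2 %| n)%N.
Proof.
case=> [[|[b e] [|? ?]]] [] //= [->] _; rewrite andbT => /eqP ee _.
rewrite dvdn2; apply/negP => nodd.
have : 0 <= \det e * \det e by rewrite -expr2 sqr_ge0.
rewrite -det_mulmx -[e *m e]/(e * e) ee expr1.
rewrite -[- 1]/(- 1%:M) -scaleN1r detZ det1 mulr1 -signr_odd nodd expr1.
by rewrite oppr_ge0 ler10.
Qed.

(** Two anticommuting complex structures make the space quaternionic. A proper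
invariant subspace W can be enlarged by the orbit v, ve, vf, vef of a vector v
outside W, and the rank grows by exactly 4: a combination of the orbit that lies
in W is v q for a quaternion q, and multiplying by the conjugate of q gives
|q|^2 v in W, hence q = 0. *)
Lemma clifford2_dvd (F : realFieldType) (n : nat) :
  has_clifford F n [:: true; true] -> (4 %| n)%N.
Proof.
case=> [[|[b e] [|[c f] [|? ?]]]] [] //= [-> ->] _.
rewrite !andbT => /andP[/eqP ee /eqP ff] /eqP ef.
pose g := e * f.
have eg : anti e g by apply: comm_anti.
have fg : anti f g by apply: anti_comm => //; exact: antiC.
have gg : g * g = -1 by rewrite anti_sq // ee ff expr1 opprK mul1r.
have efg : e *m f = g by [].
have fe : f *m e = - g by exact: antiC ef.
have ge : g *m e = f.
  by rewrite -[LHS]/(g * e) (antiC eg) /g mulrA ee mulN1r opprK.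
have gf : g *m f = - e by rewrite -[LHS]/(e * f * f) -mulrA ff mulrN1.
have ee' : e *m e = - 1%:M by [].
have ff' : f *m f = - 1%:M by [].
clearbody g.
have main k (W : 'M[F]_n) : (n - \rank W <= k)%N ->
    (W *m e <= W)%MS -> (W *m f <= W)%MS -> (4 %| n - \rank W)%N.
  elim: k W => [|k IHk] W.
    by rewrite leqn0 => /eqP->.
  case: (boolP (row_full W)) => [/eqP->|Wnf]; first by rewrite subnn.
  move=> Wk We Wf.
  have Wg : (W *m g <= W)%MS.
    rewrite -efg mulmxA; apply: submx_trans Wf; exact: submxMr.
  have [v vW] : exists v : 'rV_n, ~~ (v <= W)%MS.
    by move: Wnf; rewrite -sub1mx => /row_subPn[i iW]; exists (row i 1%:M).
  (* The rows of U form the orbit of v under the quaternion units. *)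
  pose U : 'M[_]_(1 + 1 + (1 + 1), n) := col_mx (col_mx v (v *m e)) (col_mx (v *m f) (v *m g)).
  have UW (w : 'rV_(1 + 1 + (1 + 1))) : (w *m U <= W)%MS -> w = 0.
    rewrite -[w]hsubmxK -[lsubmx w]hsubmxK -[rsubmx w]hsubmxK.
    move: (lsubmx (lsubmx w)) (rsubmx (lsubmx w)) (lsubmx (rsubmx w)) (rsubmx (rsubmx w)).
    move=> wa wb wc wd; rewrite !mul_row_col.
    rewrite [wa]mx11_scalar [wb]mx11_scalar [wc]mx11_scalar [wd]mx11_scalar.
    move: (wa 0 0) (wb 0 0) (wc 0 0) (wd 0 0) => {wa wb wc wd} a b0 c0 d.
    rewrite !mul_scalar_mx !scalemxAr -!mulmxDr => vQ.
    pose X : 'M[F]_n := b0 *: e + (c0 *: f + d *: g).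
    have XX : X * X = - (b0 ^+ 2 + c0 ^+ 2 + d ^+ 2)%:M.
      have az (x y : 'M[F]_n) (p q : F) : anti x y -> anti (p *: x) (q *: y).
        rewrite /anti -![_ * _]/(_ *m _) => xy.
        by rewrite -!scalemxAl -!scalemxAr xy !scalerN !scalerA mulrC.
      have sz (x : 'M[F]_n) (p : F) : x * x = -1 -> (p *: x) * (p *: x) = - (p ^+ 2)%:M.
        rewrite -![_ * _]/(_ *m _) => xx.
        by rewrite -scalemxAl -scalemxAr xx scalerA scalerN scalemx1 expr2.
      rewrite /X anti_sqD; last by apply: anti_add; apply: az.
      rewrite anti_sqD; last exact: az.
      by rewrite !sz // -!opprD !raddfD /= addrA.
    have vQE : a *: v + (v *m (b0 *: e)) + (v *m (c0 *: f) + v *m (d *: g)) = v *m (a%:M + X).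
      by rewrite /X !mulmxDr mul_mx_scalar -!addrA.
    pose Q : 'M[F]_n := a%:M + X; pose Q' : 'M[F]_n := a%:M - X.
    have vs : (v *m (Q *m Q') <= W)%MS.
      rewrite mulmxA; apply: (@submx_trans _ _ _ _ _ _ (W *m Q')).
        apply: submxMr; move: vQ; rewrite -vQE; congr (is_true (submx _ W)).
        by rewrite mulmxDr.
      rewrite /Q' mulmxBr mul_mx_scalar addmx_sub ?scalemx_sub //.
      rewrite eqmx_opp /X !mulmxDr -!scalemxAr.
      by rewrite !addmx_sub ?scalemx_sub.
    have QQ : Q *m Q' = (a ^+ 2 + (b0 ^+ 2 + c0 ^+ 2 + d ^+ 2))%:M.
      rewrite /Q /Q' mulmxBr; clearbody X; rewrite !mulmxDl -scalar_mxM (scalar_mxC a X) -[X *m X]/(X * X) XX.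
      by rewrite opprD opprK addrA addrK -expr2 -raddfD.
    have := vs; rewrite QQ mul_mx_scalar.
    have [s0 _|s0 sv] := eqVneq (a ^+ 2 + (b0 ^+ 2 + c0 ^+ 2 + d ^+ 2)) 0; last first.
      by case/negP: vW; rewrite -(eqmx_scale v s0).
    have [a0 [b00 [c00 d0]]] : a = 0 /\ b0 = 0 /\ c0 = 0 /\ d = 0.
      have := sqr_ge0 a; have := sqr_ge0 b0; have := sqr_ge0 c0; have := sqr_ge0 d.
      move=> h1 h2 h3 h4.
      by split; [|split; [|split]]; apply/eqP; rewrite -sqrf_eq0; apply/eqP; lra.
    by rewrite a0 b00 c00 d0 !raddf0 !row_mx0.
  have U4 : \rank U = 4%N.
    apply/eqP; rewrite -[X in _ == X]/(1 + 1 + (1 + 1))%N -/(row_free U).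
    by apply: inj_row_free => w w0; apply: UW; rewrite w0 sub0mx.
  have UW0 : (U :&: W)%MS = 0.
    apply/eqP/rowV0P => w; rewrite sub_capmx => /andP[/submxP[z ->]] /UW ->.
    by rewrite mul0mx.
  have rUW : \rank (U + W)%MS = (4 + \rank W)%N by rewrite mxrank_disjoint_sum ?U4.
  have le : (4 + \rank W <= n)%N by rewrite -rUW rank_leq_col.
  have -> : (n - \rank W = 4 + (n - \rank (U + W)%MS))%N by rewrite rUW; lia.
  have [Uv Ue Uf Ug] : [/\ v <= U, v *m e <= U, v *m f <= U & v *m g <= U]%MS.
    by have := submx_refl U; rewrite {1}/U !col_mx_sub => /andP[/andP[? ?] /andP[? ?]].
  rewrite dvdn_addr //; apply: IHk; first by rewrite rUW; lia.
  - rewrite addsmxMr addsmx_sub (submx_trans We (addsmxSr _ _)) andbT.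
    apply: submx_trans (addsmxSl _ _).
    rewrite {1}/U !mul_col_mx !col_mx_sub -!mulmxA.
    by rewrite ee' fe ge !mulmxN mulmx1 !eqmx_opp Uv Ue Uf Ug.
  - rewrite addsmxMr addsmx_sub (submx_trans Wf (addsmxSr _ _)) andbT.
    apply: submx_trans (addsmxSl _ _).
    rewrite {1}/U !mul_col_mx !col_mx_sub -!mulmxA.
    by rewrite efg ff' gf !mulmxN mulmx1 !eqmx_opp Uv Ue Uf Ug.
have := main n 0; rewrite !mul0mx mxrank0 subn0; exact.
Qed.

(** The involution x0 x1 x2 anticommutes with x3 and commutes with x0 and x1,
so half of the space still carries two anticommuting complex structures. *)
Lemma clifford4_dvd (F : realFieldType) (n : nat) :
  has_clifford F n [:: true; true; true; true] -> (8 %| n)%N.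
Proof.
case=> [[|[b0 x0] [|[b1 x1] [|[b2 x2] [|[b3 x3] [|? ?]]]]]] [] //=.
case=> -> -> -> -> _; rewrite !andbT.
case/and4P=> /eqP s0 /eqP s1 /eqP s2 /eqP s3.
case/and3P=> /and3P[/eqP a01 /eqP a02 /eqP a03] /andP[/eqP a12 /eqP a13] /eqP a23.
have T1 : (x0 * (x1 * x2)) * (x0 * (x1 * x2)) = 1.
  rewrite comm_sq; last exact: anti_mul.
  by rewrite anti_sq // s0 s1 s2 /= expr1 opprK mul1r mulrNN mulr1.
have JT : anti x3 (x0 * (x1 * x2)).
  apply: anti_comm; first exact: antiC.
  by apply: anti_mul; exact: antiC.
have [m [phi [nm p1 pN pM]]] := involution_restrict (b := true) T1 s3 JT.
have c0 : GRing.comm x0 (x0 * (x1 * x2)).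
  by apply: GRing.commrM => //; exact: anti_mul.
have c1 : GRing.comm x1 (x0 * (x1 * x2)).
  by apply: anti_mul; [exact: antiC | exact: comm_anti].
suff : (4 %| m)%N by rewrite nm -muln2 -[8%N]/(4 * 2)%N dvdn_pmul2r.
apply: (@clifford2_dvd F); exists [:: (true, phi x0); (true, phi x1)]; split=> //=.
  by rewrite -!pM // s0 s1 !pN p1 eqxx.
by rewrite -!pM // a01 pN eqxx.
Qed.

Lemma clifford_drop (A : pzRingType) (G : A -> Prop) (s t : seq bool) :
  clifford G (s ++ t) -> clifford G t.
Proof. by elim: s => //= b s IHs /clifford_behead. Qed.

(** Flipping four of the squares creates four pairs of opposite squares, and
each pair halves the space. *)
Lemma clifford8_reduce (F : numFieldType) (n s : nat) :
  has_clifford F n (nseq (8 + s) true) ->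
  exists2 m, n = (16 * m)%N & has_clifford F m (nseq s true).
Proof.
move=> /(@clifford_flip4 _ _ true (nseq (4 + s) true) (fun _ _ _ _ => I)) /= H.
have : has_clifford F n ([:: false; true; false; true; false; true; false; true] ++ nseq s true).
  apply: clifford_perm H.
  pose tail := nseq s true.
  rewrite -[X in perm_eq _ X]/([:: false; false; false; false; true; true; true; true] ++ tail).
  by rewrite perm_cat2r.
move=> /clifford_halve[m1 ->] /clifford_halve[m2 ->] /clifford_halve[m3 ->] /clifford_halve[m4 ->] Hm.
by exists m4 => //; rewrite -!muln2; lia.
Qed.

Lemma hurwitz_radon_mul16 (n : nat) : (0 < n)%N ->
  hurwitz_radon (16 * n) = (8 + hurwitz_radon n)%N.
Proof.
move=> n0; rewrite /hurwitz_radon lognM // -[16%N]/(2 ^ 4)%N pfactorK //.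
rewrite -[X in ((X + _) %/ _)%N]mul1n divnMDl // -[X in ((X + _) %% _)%N]mul1n modnMDl.
by rewrite mulnDr muln1 addnA.
Qed.

Lemma hurwitz_radon_ge (k n : nat) : (k <= 3)%N -> (0 < n)%N -> (2 ^ k %| n)%N ->
  (2 ^ k <= hurwitz_radon n)%N.
Proof.
move=> k3 n0; rewrite pfactor_dvdn // /hurwitz_radon.
move: (logn 2 n) => v kv.
have [v3|v4] := leqP v 3.
  by rewrite modn_small // divn_small // muln0 add0n leq_exp2l.
have : (1 <= v %/ 4)%N by rewrite divn_gt0.
have : (2 ^ k <= 2 ^ 3)%N by rewrite leq_exp2l.
lia.
Qed.

(** The periodicity of [clifford8_reduce] matches that of the Hurwitz-Radon
function, so only fewer than eight complex structures need a direct argument. *)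
Lemma hurwitz_radon_bound (F : realFieldType) (n s : nat) : (0 < n)%N ->
  has_clifford F n (nseq s true) -> (s < hurwitz_radon n)%N.
Proof.
have [k] := ubnP s; elim: k s n => // k IHk s n sk n0 H.
have [s8|s8] := leqP 8 s.
  have sE : s = (8 + (s - 8))%N by rewrite subnKC.
  move: H; rewrite sE => /clifford8_reduce[m nE Hm].
  have m0 : (0 < m)%N by move: n0; rewrite nE muln_gt0.
  rewrite nE hurwitz_radon_mul16 // -addnS leq_add2l.
  by apply: IHk Hm => //; lia.
have dr j : (j <= s)%N -> has_clifford F n (nseq j true).
  move=> js; apply: (@clifford_drop _ _ (nseq (s - j) true)).
  by rewrite -nseqD subnK.
have ge := hurwitz_radon_ge _ n0.
have [s4|s4] := leqP 4 s.
  have := ge 3 isT (clifford4_dvd (dr 4%N s4)); lia.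
have [s2|s2] := leqP 2 s.
  have := ge 2 isT (clifford2_dvd (dr 2%N s2)); lia.
have [s1|s1] := leqP 1 s.
  have := ge 1 isT (clifford1_dvd (dr 1%N s1)); lia.
have := ge 0 isT (dvd1n _); lia.
Qed.

(** * Clifford systems of sign-preserving matrices *)

Definition sign_mx (R : pzRingType) (m n : nat) (M : 'M[R]_(m, n)) : Prop :=
  forall i j, M i j = 1 \/ M i j = -1.

(** Signed permutation matrices, described by what is used of them; in this form
the closure under products and blocks is immediate. *)
Definition sign_isometry (R : pzRingType) (n : nat) (P : 'M[R]_n) : Prop :=
  P *m P^T = 1%:M /\
  forall k (v : 'M[R]_(n, k)), sign_mx v -> sign_mx (P *m v).

Lemma clifford_map (A B : pzRingType) (G : A -> Prop) (H : B -> Prop)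
    (phi : A -> B) (s : seq bool) :
  phi 1 = 1 -> (forall x, phi (- x) = - phi x) ->
  (forall x y, phi (x * y) = phi x * phi y) -> (forall x, G x -> H (phi x)) ->
  clifford G s -> clifford H s.
Proof.
move=> p1 pN pM GH [es [<- GE sq pw]].
exists [seq (e.1, phi e.2) | e <- es]; split.
- by rewrite -map_comp; exact: eq_map.
- by move=> e /mapP[d din ->]; exact/GH/GE.
- rewrite all_map; apply/allP => d din /=.
  have /= /eqP dd := allP sq _ din.
  by rewrite -pM dd; case: d.1; rewrite ?expr1 ?expr0 ?pN ?p1.
rewrite pairwise_map; apply: sub_pairwise pw => x y /= /eqP xy.
by rewrite -!pM xy pN.
Qed.

(** Multiplying by a fixed element x of square 1 flips the squares of all the
elements that anticommute with x. *)
Lemma clifford_twist (A : pzRingType) (G : A -> Prop) (s : seq bool) :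
  (forall x y, G x -> G y -> G (x * y)) ->
  clifford G (false :: s) -> clifford G (false :: map negb s).
Proof.
move=> GM [[|[b x] es] [] //= [-> <-] GE /andP[/eqP xx sq] /andP[/allP xa pw]].
have Gx : G x by apply: (GE (false, x)); rewrite mem_head.
exists ((false, x) :: [seq (~~ e.1, e.2 * x) | e <- es]); split=> //=.
- by rewrite -!map_comp.
- move=> e; rewrite inE => /orP[/eqP-> //|/mapP[d din ->]] /=.
  by apply: (GM) => //; apply: GE; rewrite inE din orbT.
- rewrite xx eqxx /= all_map; apply/allP => d din /=.
  have /= /eqP dd := allP sq _ din.
  rewrite anti_sq; last by apply/antiC/eqP; exact: xa.
  by rewrite dd xx mulr1; case: d.1; rewrite ?expr1 ?expr0 ?opprK.
apply/andP; split.
  rewrite all_map; apply/allP => d din /=; apply/eqP.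
  by apply: anti_comm => //; apply/eqP; exact: xa.
rewrite pairwise_map; apply/(pairwiseP (false, 0)) => i j ii jj ij /=.
have xn k : k \in gtn (size es) -> anti (nth (false, 0) es k).2 x.
  by move=> kk; apply/antiC/eqP; apply: xa; apply: mem_nth.
apply/eqP; apply: anti_mulr; [exact: xx | | exact: xn | exact: xn].
by apply/eqP; exact: (pairwiseP _ pw _ _ ii jj ij).
Qed.

(** The product of an even number of anticommuting elements anticommutes with
each of them; for two or six complex structures it squares to -1. *)
Lemma clifford_add_prod2 (A : pzRingType) (G : A -> Prop) :
  (forall x y, G x -> G y -> G (x * y)) ->
  clifford G (nseq 2 true) -> clifford G (nseq 3 true).
Proof.
move=> GM [[|[b x] [|[c y] [|? ?]]] [] //= [-> ->] GE].
rewrite !andbT => /andP[/eqP xx /eqP yy] /eqP xy.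
have Gx : G x by apply: (GE (true, x)); rewrite !inE eqxx.
have Gy : G y by apply: (GE (true, y)); rewrite !inE eqxx orbT.
exists [:: (true, x); (true, y); (true, x * y)]; split=> //=.
- by move=> e; rewrite !inE => /or3P[] /eqP -> //=; exact: GM.
- by rewrite xx yy anti_sq // xx yy expr1 opprK mul1r eqxx.
have xw : anti x (x * y) by exact: comm_anti.
have yw : anti y (x * y) by apply: anti_comm => //; exact: antiC.
by do !(apply/andP; split=> //); apply/eqP.
Qed.

Lemma clifford_add_prod6 (A : pzRingType) (G : A -> Prop) :
  (forall x y, G x -> G y -> G (x * y)) ->
  clifford G (nseq 6 true) -> clifford G (nseq 7 true).
Proof.
move=> GM [es [sE GE sqE pwE]].
case: es sE GE sqE pwE => [|[c0 x0] [|[c1 x1] [|[c2 x2] [|[c3 x3] [|[c4 x4] [|[c5 x5] [|? ?]]]]]]] //=.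
case=> -> -> -> -> -> -> GE.
rewrite !andbT expr1 => /and5P[/eqP s0 /eqP s1 /eqP s2 /eqP s3 /andP[/eqP s4 /eqP s5]].
case/and5P=> /and5P[/antiP a01 /antiP a02 /antiP a03 /antiP a04 /antiP a05].
case/and4P=> /antiP a12 /antiP a13 /antiP a14 /antiP a15.
case/and3P=> /antiP a23 /antiP a24 /antiP a25 /andP[/antiP a34 /antiP a35] /antiP a45.
have sq2 x y : x * x = -1 -> y * y = -1 -> anti x y -> (x * y) * (x * y) = -1.
  by move=> xx yy xy; rewrite anti_sq // xx yy opprK mul1r.
have al x y : anti x y -> anti x (x * y) by exact: comm_anti.
have ar x y : anti y x -> anti x (y * x) by move=> /antiC xy; exact: anti_comm.
have pair_comm x y z t : anti x z -> anti x t -> anti y z -> anti y t ->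
    GRing.comm (x * y) (z * t).
  move=> xz xt yz yt; apply: GRing.commr_sym.
  by apply: GRing.commrM; apply: GRing.commr_sym; exact: anti_mul.
pose w := x0 * x1 * ((x2 * x3) * (x4 * x5)).
have ww : w * w = -1.
  rewrite comm_sq; last by apply: GRing.commrM; exact: pair_comm.
  rewrite (@comm_sq _ (x2 * x3)); last exact: pair_comm.
  by rewrite !sq2 // !mulrNN !mulr1.
have lft x p q r : anti x p -> GRing.comm x q -> GRing.comm x r -> anti x (p * (q * r)).
  by move=> xp xq xr; apply: anti_comm => //; exact: GRing.commrM.
have mid x p q r : GRing.comm x p -> anti x q -> GRing.comm x r -> anti x (p * (q * r)).
  by move=> xp xq xr; apply: comm_anti => //; exact: anti_comm.
have rgt x p q r : GRing.comm x p -> GRing.comm x q -> anti x r -> anti x (p * (q * r)).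
  by move=> xp xq xr; do 2?[apply: comm_anti => //].
have w0 : anti x0 w by apply: lft; [exact: al | exact: anti_mul | exact: anti_mul].
have w1 : anti x1 w by apply: lft; [exact: ar | exact: anti_mul | exact: anti_mul].
have w2 : anti x2 w.
  by apply: mid; [apply: anti_mul; exact: antiC | exact: al | exact: anti_mul].
have w3 : anti x3 w.
  by apply: mid; [apply: anti_mul; exact: antiC | exact: ar | exact: anti_mul].
have w4 : anti x4 w.
  by apply: rgt; [apply: anti_mul; exact: antiC.. | exact: al].
have w5 : anti x5 w.
  by apply: rgt; [apply: anti_mul; exact: antiC.. | exact: ar].
have Gx x : (true, x) \in [:: (true, x0); (true, x1); (true, x2); (true, x3); (true, x4); (true, x5)] -> G x.
  by move=> xin; exact: (GE (true, x)).
exists [:: (true, x0); (true, x1); (true, x2); (true, x3); (true, x4); (true, x5); (true, w)].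
split=> //=.
- move=> e; rewrite -[_ :: _]/(rcons [:: (true, x0); (true, x1); (true, x2); (true, x3); (true, x4); (true, x5)] (true, w)).
  rewrite mem_rcons inE => /orP[/eqP-> /=|]; last exact: GE.
  by do !apply: (GM); apply: Gx; rewrite !inE eqxx ?orbT.
- by do !(apply/andP; split=> //); apply/eqP.
by do !(apply/andP; split=> //); apply/eqP.
Qed.

Section SignIsometry.
Variable R : comNzRingType.

Lemma sign_isometryM (n : nat) (P Q : 'M[R]_n) :
  sign_isometry P -> sign_isometry Q -> sign_isometry (P * Q).
Proof.
move=> [PP Ps] [QQ Qs]; split; first by rewrite trmx_mul mulmxA -(mulmxA P) QQ mulmx1.
by move=> k v sv; rewrite -mulmxA; apply: Ps; exact: Qs.
Qed.

Lemma sign_isometryN (n : nat) (P : 'M[R]_n) : sign_isometry P -> sign_isometry (- P).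
Proof.
move=> [PP Ps]; split; first by rewrite linearN /= mulmxN mulNmx opprK.
move=> k v sv i j; rewrite mulNmx mxE.
by case: (Ps k v sv i j) => ->; [right | left; rewrite opprK].
Qed.

Lemma sign_isometry1 (n : nat) : sign_isometry (1%:M : 'M[R]_n).
Proof. by split; [rewrite trmx1 mulmx1 | move=> k v; rewrite mul1mx]. Qed.

Lemma sign_col_mx (m1 m2 n : nat) (A : 'M[R]_(m1, n)) (B : 'M[R]_(m2, n)) :
  sign_mx (col_mx A B) <-> sign_mx A /\ sign_mx B.
Proof.
split=> [s|[sA sB] i j].
  by split=> i j; [have := s (lshift _ i) j | have := s (rshift _ i) j];
    rewrite ?col_mxEu ?col_mxEd.
by rewrite mxE; case: fintype.split => k.
Qed.

Lemma sign_isometry_diag (m n : nat) (P : 'M[R]_m) (Q : 'M[R]_n) :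
  sign_isometry P -> sign_isometry Q -> sign_isometry (block_mx P 0 0 Q).
Proof.
move=> [PP Ps] [QQ Qs]; split.
  by rewrite tr_block_mx mulmx_block !trmx0 !(mulmx0, mul0mx) PP QQ !(addr0, add0r) -scalar_mx_block.
move=> k v; rewrite -[v]vsubmxK mul_block_col !mul0mx addr0 add0r.
by move=> /sign_col_mx[su sd]; apply/sign_col_mx; split; [exact: Ps | exact: Qs].
Qed.

Lemma sign_isometry_antidiag (n : nat) (P Q : 'M[R]_n) :
  sign_isometry P -> sign_isometry Q -> sign_isometry (block_mx 0 P Q 0).
Proof.
move=> [PP Ps] [QQ Qs]; split.
  by rewrite tr_block_mx mulmx_block !trmx0 !(mulmx0, mul0mx) PP QQ !(addr0, add0r) -scalar_mx_block.
move=> k v; rewrite -[v]vsubmxK mul_block_col !mul0mx addr0 add0r.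
by move=> /sign_col_mx[su sd]; apply/sign_col_mx; split; [exact: Ps | exact: Qs].
Qed.

Definition signed_clifford (n : nat) := @clifford 'M[R]_n (@sign_isometry R n).

(** The inverse of [clifford_halve], on the sum of two copies of the space. *)
Lemma signed_clifford_double (n : nat) (s : seq bool) :
  signed_clifford n s -> signed_clifford (n + n) [:: false, true & s].
Proof.
case=> es [<- GE sq pw].
pose D (x : 'M[R]_n) : 'M[R]_(n + n) := block_mx x 0 0 (- x).
have DD x y : D x * D y = block_mx (x * y) 0 0 (x * y).
  rewrite -[LHS]/(_ *m _) mulmx_block !(mulmx0, mul0mx) !(addr0, add0r).
  by rewrite mulmxN mulNmx opprK.
have DN x : D (- x) = - D x by rewrite /D opp_block_mx !oppr0.
have one : 1 = block_mx 1 0 0 1 :> 'M[R]_(n + n) by exact: scalar_mx_block.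
pose f : 'M[R]_(n + n) := block_mx 0 1 1 0.
pose g : 'M[R]_(n + n) := block_mx 0 1 (-1) 0.
have fD x : anti f (D x).
  rewrite /anti -[_ * _]/(_ *m _) -[D x * f]/(_ *m _) !mulmx_block !(mulmx0, mul0mx) !(addr0, add0r).
  by rewrite !mulmx1 !mul1mx opp_block_mx opprK !oppr0.
have gD x : anti g (D x).
  rewrite /anti -[_ * _]/(_ *m _) -[D x * g]/(_ *m _) !mulmx_block !(mulmx0, mul0mx) !(addr0, add0r).
  by rewrite !mulNmx !mulmxN !mulmx1 !mul1mx opp_block_mx !opprK !oppr0.
exists [:: (false, f), (true, g) & [seq (e.1, D e.2) | e <- es]]; split=> /=.
- by rewrite -map_comp; congr [:: _, _ & _]; exact: eq_map.
- move=> e; rewrite !inE => /or3P[/eqP->|/eqP->|/mapP[d din ->]] /=.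
  + by apply: sign_isometry_antidiag; exact: sign_isometry1.
  + by apply: sign_isometry_antidiag; [|apply: sign_isometryN]; exact: sign_isometry1.
  by apply: sign_isometry_diag; [|apply: sign_isometryN]; exact: GE.
- apply/and3P; split.
  + apply/eqP; rewrite -[LHS]/(_ *m _) mulmx_block !(mulmx0, mul0mx) !(addr0, add0r).
    by rewrite !mulmx1 expr0 one.
  + apply/eqP; rewrite -[LHS]/(_ *m _) mulmx_block !(mulmx0, mul0mx) !(addr0, add0r).
    by rewrite mulmxN mulNmx !mulmx1 expr1 one opp_block_mx !oppr0.
  rewrite all_map; apply/allP => d din /=; have /= /eqP dd := allP sq _ din.
  rewrite DD dd; case: d.1; rewrite ?expr1 ?expr0 one //.
  by rewrite opp_block_mx !oppr0.
apply/and3P; split.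
apply/andP; split; last by rewrite all_map; apply/allP => d din; apply/antiP; exact: fD.
  apply/eqP; rewrite -[LHS]/(_ *m _) -[g * f]/(_ *m _) !mulmx_block !(mulmx0, mul0mx) !(addr0, add0r).
  by rewrite !mulmx1 !mul1mx opp_block_mx opprK !oppr0.
- by rewrite all_map; apply/allP => d din; apply/antiP; exact: gD.
rewrite pairwise_map; apply: sub_pairwise pw => x y /= /eqP xy.
by rewrite !DD xy opp_block_mx oppr0.
Qed.
End SignIsometry.

Section Existence.
Variable R : comNzRingType.

Lemma signed_clifford_nil (n : nat) : signed_clifford R n [::].
Proof. by exists [::]. Qed.

Lemma signed_clifford_pow2 (k : nat) :
  signed_clifford R (2 ^ k) (flatten (nseq k [:: false; true])).
Proof.
elim: k => [|k IHk]; first exact: signed_clifford_nil.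
by rewrite expnS mul2n -addnn; exact: signed_clifford_double.
Qed.

Lemma hurwitz_radon_pow2 (k : nat) :
  hurwitz_radon (2 ^ k) = (8 * (k %/ 4) + 2 ^ (k %% 4))%N.
Proof. by rewrite /hurwitz_radon pfactorK. Qed.

Let GM (n : nat) : forall x y : 'M[R]_n,
  sign_isometry x -> sign_isometry y -> sign_isometry (x * y).
Proof. exact: sign_isometryM. Qed.

(** The inverse of [clifford8_reduce]. *)
Lemma signed_clifford8 (n s : nat) :
  signed_clifford R n (nseq s true) -> signed_clifford R (16 * n) (nseq (8 + s) true).
Proof.
do 4!move=> /signed_clifford_double; set N := (X in signed_clifford R X _).
have -> : (16 * n = N)%N by rewrite /N; lia.
move=> H; apply: (@clifford_flip4 _ _ false (nseq (4 + s) true) (@GM _)).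
refine (clifford_perm _ H).
pose tail := nseq s true.
rewrite -[X in perm_eq _ X]/([:: false; true; false; true; false; true; false; true] ++ tail).
rewrite -[X in perm_eq X _]/([:: false; false; false; false; true; true; true; true] ++ tail).
by rewrite perm_cat2r.
Qed.

(** Below eight complex structures, the orders 1, 2, 4 and 8 carry 0, 1, 3 and 7
of them: in orders 4 and 8 the last one is the product of the others, and in
order 8 the six others come from three doublings by [clifford_twist] and
[clifford_flip4]. *)
Lemma signed_clifford_hurwitz_pow2 (k : nat) :
  signed_clifford R (2 ^ k) (nseq (hurwitz_radon (2 ^ k)).-1 true).
Proof.
have [j] := ubnP k; elim: j k => // j IHj k kj.
have [k4|k4] := leqP 4 k.
  have -> : k = (4 + (k - 4))%N by rewrite subnKC.
  rewrite expnD hurwitz_radon_mul16 ?expn_gt0 //.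
  have h0 : (0 < hurwitz_radon (2 ^ (k - 4)))%N.
    by rewrite /hurwitz_radon addn_gt0 expn_gt0 orbT.
  rewrite -[(_ + _).-1]subn1 -addnBA // subn1.
  by apply: signed_clifford8; apply: IHj; lia.
rewrite hurwitz_radon_pow2 divn_small // modn_small // muln0 add0n.
have H := signed_clifford_pow2 k.
case: k k4 kj H => [|[|[|[|//]]]] _ _ H.
- exact: signed_clifford_nil.
- exact: clifford_behead H.
- apply: clifford_add_prod2; first exact: GM.
  apply: (@clifford_drop _ _ (nseq 2 false)); by refine (clifford_perm _ H).
apply: clifford_add_prod6; first exact: GM.
apply: (@clifford_flip4 _ _ false (nseq 2 true)); first exact: GM.
suff : signed_clifford R 8 (false :: map negb [:: true; true; true; false; false]).
  by apply: clifford_perm.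
apply: clifford_twist; first exact: GM.
by refine (clifford_perm _ H).
Qed.

(** Block diagonal matrices with equal blocks, which transport a system from
order n to order u n. *)
Lemma copies_map (n u : nat) : exists phi : 'M[R]_n -> 'M[R]_(u * n),
  [/\ phi 1 = 1, (forall x, phi (- x) = - phi x),
      (forall x y, phi (x * y) = phi x * phi y) &
      forall x, sign_isometry x -> sign_isometry (phi x)].
Proof.
elim: u => [|u [phi [p1 pN pM pG]]].
  exists (fun=> 0); split=> [|x|x y|x _]; do ?by rewrite [LHS]flatmx0 [RHS]flatmx0.
  by split; [rewrite [LHS]flatmx0 [RHS]flatmx0 | move=> k v _ []].
exists (fun x => block_mx x 0 0 (phi x)); split=> [|x|x y|x Gx].
- by rewrite p1; exact/esym/(@scalar_mx_block _ n (u * n)).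
- by rewrite pN opp_block_mx !oppr0.
- by rewrite pM -[RHS]/(_ *m _) mulmx_block !(mulmx0, mul0mx) !(addr0, add0r).
by apply: sign_isometry_diag => //; exact: pG.
Qed.

Lemma signed_clifford_hurwitz (n : nat) : (0 < n)%N ->
  signed_clifford R n (nseq (hurwitz_radon n).-1 true).
Proof.
move=> n0; have [u _ nE] := pfactor_coprime (isT : prime 2) n0.
have -> : hurwitz_radon n = hurwitz_radon (2 ^ logn 2 n).
  by rewrite hurwitz_radon_pow2.
have [phi [p1 pN pM pG]] := copies_map (2 ^ logn 2 n) u.
rewrite [in signed_clifford R n]nE.
exact: clifford_map p1 pN pM pG (signed_clifford_hurwitz_pow2 _).
Qed.

(** Complex structures that are orthogonal matrices are skew, so together with
the identity they satisfy the Hurwitz-Radon relations. *)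
Theorem hurwitz_radon_family (n : nat) : (0 < n)%N ->
  exists P : nat -> 'M[R]_n,
    (forall i, (i < hurwitz_radon n)%N -> sign_isometry (P i)) /\
    (forall i j, (i < hurwitz_radon n)%N -> (j < hurwitz_radon n)%N -> i != j ->
       P i *m (P j)^T + P j *m (P i)^T = 0).
Proof.
move=> n0; have [es [sE GE sq pw]] := signed_clifford_hurwitz n0.
have sz : size es = (hurwitz_radon n).-1 by rewrite -(size_map fst) sE size_nseq.
pose e0 : bool * 'M[R]_n := (false, 0).
pose P i := if i is i'.+1 then (nth e0 es i').2 else 1%:M.
have esP i : (i.+1 < hurwitz_radon n)%N -> nth e0 es i \in es.
  by move=> ilt; apply: mem_nth; rewrite sz; lia.
have sqP i : (i.+1 < hurwitz_radon n)%N -> P i.+1 *m P i.+1 = - 1%:M.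
  move=> ilt; rewrite -[LHS]/(P i.+1 * P i.+1) (eqP (allP sq _ (esP _ ilt))).
  by rewrite -(nth_map _ false) ?sE ?nth_nseq ?ifT ?sz; [exact: expr1 | lia..].
have trP i : (i.+1 < hurwitz_radon n)%N -> (P i.+1)^T = - P i.+1.
  move=> ilt; have [PP _] := GE _ (esP _ ilt).
  have := congr1 (mulmx (P i.+1)) PP; rewrite mulmxA (sqP _ ilt) mulNmx mul1mx mulmx1.
  by move=> /(congr1 -%R); rewrite opprK.
have antiP i j : (i < j)%N -> (j < hurwitz_radon n)%N -> P i *m (P j)^T + P j *m (P i)^T = 0.
  case: j => // j; case: i => [|i] ij jlt.
    by rewrite /= trP // trmx1 mul1mx mulmx1 addNr.
  rewrite !trP //; last exact: ltn_trans jlt.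
  have sj : (j < size es)%N by rewrite sz; lia.
  have si : (i < size es)%N by lia.
  have /eqP pij := pairwiseP e0 pw _ _ si sj ij.
  by rewrite !mulmxN /= -[_ *m _]/(_ * _) pij opprK addrN.
exists P; split=> [[|i] ilt|i j ilt jlt]; first exact: sign_isometry1.
  exact: GE (esP _ ilt).
case: (ltngtP i j) => // ij _; first exact: antiP.
by rewrite addrC antiP.
Qed.
End Existence.

(** * The trace inner product and operator norms *)

Section Frobenius.
Variable R : realFieldType.

Definition frob (m n : nat) (A B : 'M[R]_(m, n)) : R := \tr (A *m B^T).
Definition fsq (m n : nat) (A : 'M[R]_(m, n)) : R := frob A A.

Lemma frobE m n (A B : 'M[R]_(m, n)) : frob A B = \sum_i \sum_j A i j * B i j.
Proof. by apply: eq_bigr => i _; rewrite mxE; apply: eq_bigr => j _; rewrite mxE. Qed.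

Lemma fsqE m n (A : 'M[R]_(m, n)) : fsq A = \sum_i \sum_j A i j ^+ 2.
Proof. by rewrite /fsq frobE. Qed.

Lemma fsq_rowE n (v : 'rV[R]_n) : fsq v = \sum_j v 0 j ^+ 2.
Proof. by rewrite fsqE big_ord1. Qed.

Lemma frobC m n (A B : 'M[R]_(m, n)) : frob A B = frob B A.
Proof. by rewrite /frob -mxtrace_tr trmx_mul trmxK. Qed.

Lemma frobDl m n (A B C : 'M[R]_(m, n)) : frob (A + B) C = frob A C + frob B C.
Proof. by rewrite /frob mulmxDl mxtraceD. Qed.

Lemma frobZl m n a (A B : 'M[R]_(m, n)) : frob (a *: A) B = a * frob A B.
Proof. by rewrite /frob -scalemxAl mxtraceZ. Qed.

Lemma frobNl m n (A B : 'M[R]_(m, n)) : frob (- A) B = - frob A B.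
Proof. by rewrite /frob mulNmx raddfN. Qed.

Lemma frobDr m n (A B C : 'M[R]_(m, n)) : frob C (A + B) = frob C A + frob C B.
Proof. by rewrite frobC frobDl !(frobC C). Qed.

Lemma frobZr m n a (A B : 'M[R]_(m, n)) : frob A (a *: B) = a * frob A B.
Proof. by rewrite frobC frobZl frobC. Qed.

Lemma frobNr m n (A B : 'M[R]_(m, n)) : frob A (- B) = - frob A B.
Proof. by rewrite frobC frobNl frobC. Qed.

Lemma frob0l m n (A : 'M[R]_(m, n)) : frob 0 A = 0.
Proof. by rewrite -(scale0r 0) frobZl mul0r. Qed.

Lemma frob_mull m n p (A : 'M[R]_(m, n)) (M : 'M[R]_(n, p)) B :
  frob (A *m M) B = frob A (B *m M^T).
Proof. by rewrite /frob trmx_mul trmxK mulmxA. Qed.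

Lemma frob_tr m n (A B : 'M[R]_(m, n)) : frob A^T B^T = frob A B.
Proof. by rewrite /frob trmxK mxtrace_mulC -/(frob B A) frobC. Qed.

Lemma fsq_tr m n (A : 'M[R]_(m, n)) : fsq A^T = fsq A.
Proof. exact: frob_tr. Qed.

Lemma fsqZ m n a (A : 'M[R]_(m, n)) : fsq (a *: A) = a ^+ 2 * fsq A.
Proof. by rewrite /fsq frobZl frobZr mulrA. Qed.

Lemma fsqN m n (A : 'M[R]_(m, n)) : fsq (- A) = fsq A.
Proof. by rewrite /fsq frobNl frobNr opprK. Qed.

Lemma fsqD m n (A B : 'M[R]_(m, n)) : fsq (A + B) = fsq A + 2 * frob A B + fsq B.
Proof. by rewrite /fsq frobDl !frobDr (frobC B A); ring. Qed.

Lemma fsqB m n (A B : 'M[R]_(m, n)) : fsq (A - B) = fsq A - 2 * frob A B + fsq B.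
Proof. by rewrite fsqD fsqN frobNr; ring. Qed.

Lemma fsq_ge0 m n (A : 'M[R]_(m, n)) : 0 <= fsq A.
Proof. by rewrite fsqE; do 2!apply: sumr_ge0 => ? _; exact: sqr_ge0. Qed.

Lemma fsq_eq0 m n (A : 'M[R]_(m, n)) : fsq A = 0 -> A = 0.
Proof.
rewrite fsqE => /eqP A0; apply/matrixP => i j; rewrite mxE; apply/eqP.
rewrite -sqrf_eq0; move: A0.
rewrite psumr_eq0 => [/allP/(_ i (mem_index_enum _))|k _]; last by apply: sumr_ge0 => ? _; exact: sqr_ge0.
by rewrite psumr_eq0 => [/allP/(_ j (mem_index_enum _))|k _]; last exact: sqr_ge0.
Qed.

Lemma frob_CS m n (A B : 'M[R]_(m, n)) : frob A B ^+ 2 <= fsq A * fsq B.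
Proof.
have [B0|B0] := eqVneq (fsq B) 0.
  by rewrite (fsq_eq0 B0) frobC frob0l expr0n /fsq frob0l mulr0.
have Bp : 0 < fsq B by rewrite lt_def B0 fsq_ge0.
have := fsq_ge0 (fsq B *: A - frob A B *: B).
rewrite fsqB !fsqZ frobZl frobZr.
have -> : fsq B ^+ 2 * fsq A - 2 * (fsq B * (frob A B * frob A B)) + frob A B ^+ 2 * fsq B
  = fsq B * (fsq A * fsq B - frob A B ^+ 2) by ring.
by rewrite pmulr_rge0 // subr_ge0.
Qed.

(** The constant [c] bounds the square of the operator norm, which avoids square
roots. *)
Definition opsq (m n : nat) (c : R) (M : 'M[R]_(m, n)) : Prop :=
  forall y : 'rV_m, fsq (y *m M) <= c * fsq y.

(** For z = y M^T the Cauchy-Schwarz inequality gives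
|z|^2 = <y, z M> <= |y| sqrt(c) |z|. *)
Lemma opsq_tr m n c (M : 'M[R]_(m, n)) : 0 <= c -> opsq c M -> opsq c M^T.
Proof.
move=> c0 cM y; set z := y *m M^T.
have zz : fsq z = frob y (z *m M) by rewrite /fsq {1}/z frob_mull trmxK.
have := frob_CS y (z *m M); rewrite -zz => h.
have h2 : fsq z ^+ 2 <= fsq y * (c * fsq z) by apply: le_trans h _; rewrite ler_wpM2l ?fsq_ge0.
have [->|z0] := eqVneq (fsq z) 0; first by rewrite mulr_ge0 ?fsq_ge0.
have zp : 0 < fsq z by rewrite lt_def z0 fsq_ge0.
by move: h2; rewrite expr2 mulrA ler_pM2r // mulrC.
Qed.

Lemma fsq_rows m n (A : 'M[R]_(m, n)) : fsq A = \sum_i fsq (row i A).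
Proof.
rewrite fsqE; apply: eq_bigr => i _; rewrite fsq_rowE.
by apply: eq_bigr => j _; rewrite mxE.
Qed.

Lemma fsq_mulr m n p c (A : 'M[R]_(m, n)) (M : 'M[R]_(n, p)) :
  opsq c M -> fsq (A *m M) <= c * fsq A.
Proof.
move=> cM; rewrite !fsq_rows mulr_sumr; apply: ler_sum => i _.
by rewrite row_mul.
Qed.

Lemma fsq_mull m n p c (A : 'M[R]_(m, n)) (M : 'M[R]_(p, m)) :
  0 <= c -> opsq c M -> fsq (M *m A) <= c * fsq A.
Proof.
move=> c0 cM; rewrite -fsq_tr trmx_mul -(fsq_tr A).
by apply: fsq_mulr; exact: opsq_tr.
Qed.

Lemma fsq_delta n (a : 'I_n) : fsq (delta_mx 0 a : 'rV[R]_n) = 1.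
Proof.
rewrite fsq_rowE (bigD1 a) //= big1 ?addr0 => [|j ja]; rewrite mxE ?eqxx ?expr1n //.
by rewrite (negPf ja) andbF expr0n.
Qed.
End Frobenius.

(** * The norm of a trilinear form *)

Section FormNorm.
Variable R : realType.

Lemma enormE d (x : 'rV[R]_d) : enorm x = Num.sqrt (fsq x).
Proof. by rewrite /enorm fsq_rowE. Qed.

Lemma enorm_le1 d (x : 'rV[R]_d) : (enorm x <= 1) = (fsq x <= 1).
Proof. by rewrite enormE -[X in _ <= X]sqrtr1 ler_sqrt. Qed.

Definition slice r m n (e : 'I_r -> 'I_m -> 'I_n -> R) (i : 'I_r) : 'M[R]_(m, n) :=
  \matrix_(j, k) e i j k.

Definition pencil r m n (E : 'I_r -> 'M[R]_(m, n)) (x : 'rV[R]_r) : 'M[R]_(m, n) :=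
  \sum_i x 0 i *: E i.

Lemma triformE r m n (e : 'I_r -> 'I_m -> 'I_n -> R) x y z :
  triform e x y z = frob (y *m pencil (slice e) x) z.
Proof.
rewrite frobE big_ord1 /triform exchange_big /=.
under [RHS]eq_bigr => k _ do rewrite mxE mulr_suml.
rewrite [RHS]exchange_big; apply: eq_bigr => j _ /=.
rewrite exchange_big; apply: eq_bigr => k _ /=.
rewrite summxE mulr_sumr mulr_suml; apply: eq_bigr => i _.
by rewrite !mxE; ring.
Qed.

Lemma coord_le1 d (x : 'rV[R]_d) i : enorm x <= 1 -> `|x 0 i| <= 1.
Proof.
rewrite enorm_le1 => x1; have : x 0 i ^+ 2 <= 1.
  apply: le_trans x1; rewrite fsq_rowE (bigD1 i) //= lerDl.
  by apply: sumr_ge0 => j _; exact: sqr_ge0.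
by rewrite -real_normK ?num_real // expr_le1.
Qed.

Variables (r m n : nat) (e : 'I_r -> 'I_m -> 'I_n -> R).

Lemma triform_le_form_norm x y z : enorm x <= 1 -> enorm y <= 1 -> enorm z <= 1 ->
  `|triform e x y z| <= form_norm (triform e).
Proof.
move=> x1 y1 z1; apply: ub_le_sup; last by exists x, y, z.
exists (\sum_i \sum_j \sum_k `|e i j k|) => _ [x' [y' [z' [x1' y1' z1' ->]]]].
rewrite /triform; do 3!(apply: le_trans (ler_norm_sum _ _ _) _; apply: ler_sum => ? _).
rewrite !normrM -!mulrA ler_piMr // mulr_ile1 ?mulr_ge0 ?coord_le1 //.
by rewrite mulr_ile1 ?coord_le1.
Qed.

Lemma form_norm_ge0 : 0 <= form_norm (triform e).
Proof.
have h d : enorm (0 : 'rV[R]_d) <= 1 by rewrite enorm_le1 /fsq frob0l.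
by apply: le_trans (triform_le_form_norm (h _) (h _) (h _)).
Qed.

(** The supremum over unit balls controls all vectors by homogeneity. *)
Lemma triform_homog x y z : `|triform e x y z| <=
  form_norm (triform e) * (enorm x * (enorm y * enorm z)).
Proof.
have en d (v : 'rV[R]_d) : v = 0 \/ exists2 w : 'rV[R]_d, enorm w <= 1 & v = enorm v *: w.
  have [v0|v0] := eqVneq (fsq v) 0; [by left; exact: fsq_eq0|right].
  have vp : 0 < fsq v by rewrite lt_def v0 fsq_ge0.
  have sp : Num.sqrt (fsq v) != 0 by rewrite sqrtr_eq0 -ltNge.
  exists ((enorm v)^-1 *: v); last by rewrite scalerA mulfV ?scale1r // enormE.
  by rewrite enorm_le1 fsqZ enormE exprVn sqr_sqrtr ?fsq_ge0 // mulVf.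
have s0 d (v : 'rV[R]_d) : 0 <= enorm v by rewrite enormE sqrtr_ge0.
have t0 u v w : 0 <= form_norm (triform e) * (enorm u * (enorm v * enorm w)).
  by rewrite !mulr_ge0 ?form_norm_ge0.
case: (en _ z) => [->|[z' z1 zE]]; first by rewrite triformE frobC frob0l normr0.
case: (en _ y) => [->|[y' y1 yE]]; first by rewrite triformE mul0mx frob0l normr0.
case: (en _ x) => [->|[x' x1 xE]].
  rewrite triformE /pencil big1 => [|i _]; last by rewrite mxE scale0r.
  by rewrite mulmx0 frob0l normr0.
have pZ a v : pencil (slice e) (a *: v) = a *: pencil (slice e) v.
  by rewrite /pencil scaler_sumr; apply: eq_bigr => i _; rewrite mxE scalerA.
rewrite {1}xE {1}yE {1}zE triformE pZ -scalemxAr -scalemxAl frobZl frobZl frobZr -triformE.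
rewrite !normrM !(ger0_norm (s0 _ _)).
rewrite !mulrA -[X in X <= _]mulrC -!mulrA ler_wpM2r //.
  by rewrite !mulr_ge0.
by apply: triform_le_form_norm.
Qed.

(** Duality: apply [triform_homog] to the vector z = y M_x itself. *)
Lemma form_norm_pencil (x : 'rV[R]_r) (y : 'rV[R]_m) :
  fsq (y *m pencil (slice e) x) <= form_norm (triform e) ^+ 2 * fsq x * fsq y.
Proof.
set z := y *m _; have := triform_homog x y z.
rewrite triformE -/z -/(fsq z) ger0_norm ?fsq_ge0 // => h.
have h2 : fsq z ^+ 2 <= (form_norm (triform e) ^+ 2 * fsq x * fsq y) * fsq z.
  apply: le_trans (_ : (form_norm (triform e) * (enorm x * (enorm y * enorm z))) ^+ 2 <= _).
    by rewrite ler_sqr ?nnegrE ?fsq_ge0 // (le_trans (fsq_ge0 z) h).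
  by rewrite !exprMn !enormE !sqr_sqrtr ?fsq_ge0 // !mulrA.
have [->|z0] := eqVneq (fsq z) 0; first by rewrite !mulr_ge0 ?fsq_ge0 ?sqr_ge0 ?form_norm_ge0.
have zp : 0 < fsq z by rewrite lt_def z0 fsq_ge0.
by move: h2; rewrite expr2 ler_pM2r.
Qed.

Lemma form_norm_le c : 0 <= c ->
  (forall (x : 'rV[R]_r) (y : 'rV[R]_m), fsq (y *m pencil (slice e) x) <= c ^+ 2 * fsq x * fsq y) ->
  form_norm (triform e) <= c.
Proof.
move=> c0 H; apply: ge_sup.
  by exists `|triform e 0 0 0|; exists 0, 0, 0; rewrite !enorm_le1 /fsq !frob0l ler01.
move=> _ [x [y [z [x1 y1 z1 ->]]]].
rewrite -ler_sqr ?nnegrE // real_normK ?num_real // triformE.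
apply: le_trans (frob_CS _ _) _; move: x1 y1 z1; rewrite !enorm_le1 => x1 y1 z1.
apply: le_trans (_ : fsq (y *m pencil (slice e) x) * 1 <= _); first by rewrite ler_wpM2l ?fsq_ge0.
rewrite mulr1; apply: le_trans (H x y) _; rewrite -mulrA ler_piMr ?sqr_ge0 //.
by rewrite mulr_ile1 ?fsq_ge0.
Qed.

End FormNorm.

(** * The Hurwitz-Radon relations *)

Section Pencil.
Variables (R : realType) (r m n : nat) (E : 'I_r -> 'M[R]_(m, n)).

Lemma pencil_delta i : pencil E (delta_mx 0 i) = E i.
Proof.
rewrite /pencil (bigD1 i) //= mxE !eqxx scale1r big1 ?addr0 // => j ji.
by rewrite mxE (negPf ji) andbF scale0r.
Qed.

Lemma pencilD x y : pencil E (x + y) = pencil E x + pencil E y.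
Proof. by rewrite /pencil -big_split; apply: eq_bigr => i _; rewrite mxE scalerDl. Qed.

Lemma pencilZ a x : pencil E (a *: x) = a *: pencil E x.
Proof. by rewrite /pencil scaler_sumr; apply: eq_bigr => i _; rewrite mxE scalerA. Qed.

(** For E = (E_i) these say that E_i E_i^T = c and that E_i E_j^T is skew for
distinct i and j. *)
Definition hurwitz_relations (c : R) : Prop :=
  forall i j, E i *m (E j)^T + E j *m (E i)^T = ((i == j)%:R * (2 * c))%:M.

(** Expanding the square of the pencil, the cross terms cancel in pairs. *)
Lemma pencil_gram c x : hurwitz_relations c ->
  pencil E x *m (pencil E x)^T = (c * fsq x)%:M.
Proof.
move=> H.
have two : (2 : R) != 0 by rewrite pnatr_eq0.
have gramE : pencil E x *m (pencil E x)^T = \sum_i \sum_j (x 0 i * x 0 j) *: (E i *m (E j)^T).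
  rewrite /pencil linear_sum /= mulmx_suml; apply: eq_bigr => i _.
  rewrite mulmx_sumr; apply: eq_bigr => j _.
  by rewrite linearZ /= -scalemxAl -scalemxAr scalerA.
have gramE2 := gramE; rewrite exchange_big /= in gramE2.
apply: (scalerI two); rewrite scaler_nat mulr2n {1}gramE {1}gramE2 -big_split /=.
transitivity (\sum_i (x 0 i ^+ 2 * (2 * c))%:M : 'M[R]_m).
  apply: eq_bigr => i _; rewrite -big_split (bigD1 i) //= big1 ?addr0 => [|j ji].
    by rewrite -scalerDr H eqxx mul1r scale_scalar_mx expr2.
  rewrite [x 0 j * _]mulrC -scalerDr H; have [ij|_] := eqVneq; last by rewrite mul0r raddf0 scaler0.
  by rewrite ij eqxx in ji.
by rewrite -raddf_sum -mulr_suml -fsq_rowE /= scale_scalar_mx; congr (_%:M); ring.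
Qed.

Lemma fsq_pencil c x (y : 'rV[R]_m) : hurwitz_relations c ->
  fsq (y *m pencil E x) = c * fsq x * fsq y.
Proof.
move=> H; rewrite /fsq frob_mull -mulmxA (pencil_gram _ H) mul_mx_scalar frobZr.
by rewrite -/(fsq x).
Qed.
End Pencil.

Lemma fsq_sign_row (R : realFieldType) (n : nat) (v : 'rV[R]_n) : sign_mx v -> fsq v = n%:R.
Proof.
move=> sv; rewrite fsq_rowE (eq_bigr (fun=> 1)) ?sumr_const ?card_ord // => j _.
by case: (sv 0 j) => ->; rewrite ?sqrrN expr1n.
Qed.

(** * Sign forms of nearly minimal norm *)

Section SignForms.
Variables (R : realType) (r m n : nat) (e : 'I_r -> 'I_m -> 'I_n -> R).
Hypothesis e1 : forall i j k, e i j k = 1 \/ e i j k = -1.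
Let E := slice e.
Let nu := form_norm (triform e) ^+ 2.

Lemma row_slice i j : fsq (row j (E i)) = n%:R.
Proof. by apply: fsq_sign_row => i0 k; rewrite !mxE. Qed.

Lemma form_norm_sqr_ge : (0 < r)%N -> (0 < m)%N -> n%:R <= nu.
Proof.
move=> r0 m0; pose i : 'I_r := Ordinal r0; pose j : 'I_m := Ordinal m0.
have := form_norm_pencil e (delta_mx 0 i) (delta_mx 0 j).
by rewrite pencil_delta -rowE row_slice !fsq_delta !mulr1.
Qed.

Lemma form_norm_ge : (0 < r)%N -> (0 < m)%N -> Num.sqrt n%:R <= form_norm (triform e).
Proof.
move=> r0 m0; rewrite -ler_sqr ?nnegrE ?sqrtr_ge0 ?form_norm_ge0 //.
by rewrite sqr_sqrtr ?ler0n // form_norm_sqr_ge.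
Qed.

Lemma gram_int i j a b : (E i *m (E j)^T) a b \is a Num.int.
Proof.
rewrite mxE rpred_sum // => k _; rewrite !mxE.
by case: (e1 i a k) => ->; case: (e1 j b k) => ->; rewrite ?(mulrN, mulNr, opprK) ?mulr1 ?rpredN rpred1.
Qed.

Lemma gram_diag i a : (E i *m (E i)^T) a a = n%:R.
Proof.
rewrite mxE (eq_bigr (fun=> 1)) ?sumr_const ?card_ord // => k _; rewrite !mxE.
by case: (e1 i a k) => ->; rewrite ?mulrNN mulr1.
Qed.

Lemma fsq_delta_mul (M : 'M[R]_m) a b (t : R) : M^T = M ->
  frob ((delta_mx 0 a + t *: delta_mx 0 b : 'rV[R]_m) *m M) (delta_mx 0 a + t *: delta_mx 0 b)
  = M a a + 2 * t * M a b + t ^+ 2 * M b b.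
Proof.
move=> MT.
have d c d : frob ((delta_mx 0 c : 'rV[R]_m) *m M) (delta_mx 0 d) = M c d.
  rewrite -rowE frobE big_ord1 (bigD1 d) //= big1 ?addr0 => [|k kd]; rewrite !mxE ?eqxx ?mulr1 //.
  by rewrite (negPf kd) andbF mulr0.
rewrite mulmxDl -scalemxAl frobDl !frobDr !frobZl !frobZr !d.
have -> : M b a = M a b by rewrite -{1}MT mxE.
ring.
Qed.

Lemma int_small (x : R) : x \is a Num.int -> `|x| < 1 -> x = 0.
Proof.
move=> xi x1; apply/eqP; apply/negPn/negP => x0.
by have := norm_intr_ge1 xi x0; rewrite leNgt x1.
Qed.

(** The rows of E_i have squared length n. If two of them had a nonzero inner
product t, an integer, then E_i^T would map the unit vector (e_a +- e_b)/sqrt(2)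
to a vector of squared length n + |t|, at least n + 1. *)
Lemma small_norm_hadamard i : nu < n%:R + 1 -> E i *m (E i)^T = (n%:R)%:M.
Proof.
move=> nu1; apply/matrixP => a b; rewrite [RHS]mxE.
have [<-|ab] := eqVneq a b; first by rewrite gram_diag mulr1n.
rewrite mulr0n; apply: int_small; first exact: gram_int.
set M := E i *m (E i)^T.
have MT : M^T = M by rewrite trmx_mul trmxK.
have h (t : R) : t ^+ 2 = 1 -> 2 * n%:R + 2 * t * M a b <= 2 * nu.
  move=> t1; have := form_norm_pencil e (delta_mx 0 i) (delta_mx 0 a + t *: delta_mx 0 b).
  rewrite pencil_delta /fsq frob_mull -mulmxA -/E -/M frobC fsq_delta_mul // !gram_diag -/nu.
  rewrite -!/(fsq _) fsq_delta fsqD fsqZ frobZr !fsq_delta t1.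
  have -> : frob (delta_mx 0 a : 'rV[R]_m) (delta_mx 0 b) = 0.
    rewrite frobE big_ord1 big1 // => k _; rewrite !mxE eqxx /=.
    by case: eqP => [->|_]; rewrite ?mul0r // (negPf ab) mulr0.
  lra.
have h1 := h 1 (expr1n _ _); have h2 := h (-1) (etrans (sqrrN 1) (expr1n _ _)).
rewrite ltr_norml; apply/andP; split; lra.
Qed.

(** For the unit vector x = (e_i + s e_j)/sqrt(2) with s = +-1, the Gram matrix
of the pencil is n + s S/2, where S is the anticommutator below. Thus the
quadratic form of S is at most 2 (nu - n) in absolute value on unit vectors, and
testing it on (e_a +- e_b)/sqrt(2) isolates the entry S_ab. *)
Lemma small_norm_anticomm i j : i != j -> nu < n%:R + 1 ->
  forall a b, `|(E i *m (E j)^T + E j *m (E i)^T) a b| <= 2 * (nu - n%:R).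
Proof.
move=> ij nu1 a b.
have Hi := small_norm_hadamard i nu1; have Hj := small_norm_hadamard j nu1.
set S := E i *m (E j)^T + E j *m (E i)^T.
have ST : S^T = S by rewrite linearD /= !trmx_mul !trmxK addrC.
have fij : frob (delta_mx 0 i : 'rV[R]_r) (delta_mx 0 j) = 0.
  rewrite frobE big_ord1 big1 // => k _; rewrite !mxE eqxx /=.
  by case: eqP => [->|_]; rewrite ?mul0r // (negPf ij) mulr0.
have h (s : R) (y : 'rV[R]_m) : s ^+ 2 = 1 -> s * frob (y *m S) y <= 2 * (nu - n%:R) * fsq y.
  move=> s1; have := form_norm_pencil e (delta_mx 0 i + s *: delta_mx 0 j) y.
  rewrite pencilD pencilZ !pencil_delta -/E fsqD fsqZ frobZr fij !fsq_delta s1 -/nu.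
  rewrite {1}/fsq frob_mull -mulmxA linearD linearZ /=.
  have -> : (E i + s *: E j) *m ((E i)^T + s *: (E j)^T) = (2 * n%:R)%:M + s *: S.
    rewrite mulmxDl !mulmxDr -!scalemxAl -!scalemxAr scalerA -expr2 s1 scale1r Hi Hj.
    rewrite [X in _ + X]addrC addrACA -scalerDr -raddfD /=; congr (_%:M + _); ring.
  rewrite mulmxDr mul_mx_scalar -scalemxAr frobDr !frobZr -/(fsq y) frobC; lra.
have p1 : (1 : R) ^+ 2 = 1 by rewrite expr1n.
have m1 : (-1 : R) ^+ 2 = 1 by rewrite sqrrN expr1n.
have [<-|ab] := eqVneq a b.
  have d : frob ((delta_mx 0 a : 'rV[R]_m) *m S) (delta_mx 0 a) = S a a.
    by have := @fsq_delta_mul S a a 0 ST; rewrite !scale0r !addr0 expr0n /= mulr0 !mul0r !addr0.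
  have := h 1 (delta_mx 0 a) p1; have := h (-1) (delta_mx 0 a) m1.
  rewrite d fsq_delta => h1 h2; rewrite ler_norml; apply/andP; split; lra.
have fab : frob (delta_mx 0 a : 'rV[R]_m) (delta_mx 0 b) = 0.
  rewrite frobE big_ord1 big1 // => k _; rewrite !mxE eqxx /=.
  by case: eqP => [->|_]; rewrite ?mul0r // (negPf ab) mulr0.
have h2 (s t : R) : s ^+ 2 = 1 -> t ^+ 2 = 1 ->
    s * (S a a + 2 * t * S a b + S b b) <= 4 * (nu - n%:R).
  move=> s1 t1; have := h s (delta_mx 0 a + t *: delta_mx 0 b) s1.
  rewrite fsq_delta_mul // fsqD fsqZ frobZr fab !fsq_delta t1; lra.
have := h2 1 1 p1 p1; have := h2 1 (-1) p1 m1; have := h2 (-1) 1 m1 p1; have := h2 (-1) (-1) m1 m1.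
move=> h3 h4 h5 h6; rewrite ler_norml; apply/andP; split; lra.
Qed.

(** The entries of the anticommutators are integers smaller than 1, hence zero.
For 1 x 1 matrices the unique entry of an anticommutator is even, which doubles
the admissible range. *)
Lemma small_norm_relations :
  nu < n%:R + 2^-1 \/ (m = 1%N /\ nu < n%:R + 1) -> hurwitz_relations E n%:R.
Proof.
move=> small; have nu1 : nu < n%:R + 1 by case: small => [h|[_ //]]; lra.
move=> i j; have [<-|ij] := eqVneq i j.
  by rewrite small_norm_hadamard // -raddfD /= mul1r; congr (_%:M); ring.
rewrite mul0r raddf0; apply/matrixP => a b; rewrite [RHS]mxE.
have le := small_norm_anticomm ij nu1 a b.
case: small => [h|[m1 _]].
  apply: int_small; last by apply: le_lt_trans le _; lra.
  by rewrite mxE rpredD ?gram_int.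
have ba : b = a by apply: val_inj => /=; have := ltn_ord a; have := ltn_ord b; lia.
rewrite ba in le *.
have g : (E j *m (E i)^T) a a = (E i *m (E j)^T) a a.
  by rewrite -[in RHS](trmxK (E i)) -trmx_mul [RHS]mxE.
have g0 : (E i *m (E j)^T) a a = 0.
  apply: int_small; first exact: gram_int.
  move: le; rewrite mxE g -mulr2n -[_ *+ 2]mulr_natl normrM ger0_norm // => le; lra.
by rewrite mxE g g0 addr0.
Qed.

End SignForms.

(** * Extremal forms and the gap above them *)

Section Extremal.
Variable R : realType.

Lemma sliceK (r m n : nat) (E : 'I_r -> 'M[R]_(m, n)) :
  slice (fun i j k => E i j k) = E.
Proof. by apply/funext => i; apply/matrixP => j k; rewrite mxE. Qed.

(** A Hurwitz-Radon family P acts on the left on X: the Gram matrices of P_i X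
are those of P_i multiplied by n, and sign preservation keeps the entries +-1. *)
Lemma hurwitz_relations_exist (r n : nat) (X : 'M[R]_n) : (0 < n)%N ->
  sign_mx X -> X *m X^T = n%:R%:M -> (r <= hurwitz_radon n)%N ->
  exists e : 'I_r -> 'I_n -> 'I_n -> R,
    (forall i j k, e i j k = 1 \/ e i j k = -1) /\ hurwitz_relations (slice e) n%:R.
Proof.
move=> n0 Xs XX rn; have [P [Ps PP]] := hurwitz_radon_family R n0.
have lt (i : 'I_r) : (i < hurwitz_radon n)%N by exact: leq_trans (ltn_ord i) rn.
exists (fun i j k => (P i *m X) j k); split=> [i j k|]; first by case: (Ps i (lt i)) => _; apply.
rewrite (sliceK (fun i => P (nat_of_ord i) *m X)) => i j.
have G a b : P a *m X *m (P b *m X)^T = n%:R *: (P a *m (P b)^T).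
  by rewrite trmx_mul mulmxA -[_ *m X *m _]mulmxA XX mul_mx_scalar -scalemxAl.
rewrite !G; have [<-|ij] := eqVneq i j.
  have [-> _] := Ps i (lt i).
  by rewrite scale_scalar_mx mulr1 -raddfD mul1r /=; congr (_%:M); ring.
by rewrite -scalerDr PP ?lt // scaler0 mul0r raddf0.
Qed.

Lemma form_norm_relations (r n : nat) (e : 'I_r -> 'I_n -> 'I_n -> R) :
  hurwitz_relations (slice e) n%:R -> form_norm (triform e) <= Num.sqrt n%:R.
Proof.
move=> H; apply: form_norm_le; first exact: sqrtr_ge0.
by move=> x y; rewrite (fsq_pencil _ _ H) sqr_sqrtr.
Qed.

(** The matrices U_i = E_i E_0^T / n are anticommuting complex structures, since
the relation between E_0 and E_j turns U_i U_j into - E_i E_j^T / n. *)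
Lemma relations_hurwitz_radon (r n : nat) (E : 'I_r.+1 -> 'M[R]_n) : (0 < n)%N ->
  hurwitz_relations E n%:R -> (r < hurwitz_radon n)%N.
Proof.
move=> n0 H; have nu : (n%:R : R) != 0 by rewrite pnatr_eq0 -lt0n.
have two : (2 : R) != 0 by rewrite pnatr_eq0.
have HH i : E i *m (E i)^T = n%:R%:M.
  apply: (scalerI two); rewrite scaler_nat mulr2n H eqxx mul1r.
  by rewrite scale_scalar_mx.
have HT : (E ord0)^T *m E ord0 = n%:R%:M.
  have : E ord0 *m (n%:R^-1 *: (E ord0)^T) = 1%:M.
    by rewrite -scalemxAr HH scale_scalar_mx mulVf.
  move=> /mulmx1C; rewrite -scalemxAl => /(congr1 ( *:%R n%:R)).
  by rewrite scalerA mulfV // scale1r scale_scalar_mx mulr1.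
pose U (i : 'I_r) : 'M[R]_n := n%:R^-1 *: (E (lift ord0 i) *m (E ord0)^T).
have UU i j : U i *m U j = - (n%:R^-1 *: (E (lift ord0 i) *m (E (lift ord0 j))^T)).
  rewrite /U -scalemxAl -scalemxAr.
  have -> : E (lift ord0 j) *m (E ord0)^T = - (E ord0 *m (E (lift ord0 j))^T).
    by apply/eqP; rewrite -addr_eq0 H mul0r raddf0.
  rewrite mulmxN mulmxA -(mulmxA (E (lift ord0 i))) HT mul_mx_scalar -scalemxAl.
  by rewrite !scalerN !scalerA -?mulrA mulVf // mulr1.
apply: (@hurwitz_radon_bound R) => //.
exists [seq (true, U i) | i <- enum 'I_r]; split=> //.
- rewrite -map_comp /= (eq_map (g := fun=> true)) //.
  by rewrite -[in RHS](size_enum_ord r); elim: (enum _) => //= a s ->.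
- rewrite all_map; apply/allP => i _ /=; rewrite -[_ * _]/(U i *m U i) UU HH.
  by rewrite scale_scalar_mx mulVf // expr1.
rewrite pairwise_map; have := enum_uniq 'I_r; rewrite uniq_pairwise.
apply: sub_pairwise => i j /= ij.
rewrite -[_ * _]/(U i *m U j) -[U j * _]/(U j *m U i) !UU opprK -scalerN.
have := H (lift ord0 i) (lift ord0 j).
rewrite (inj_eq (@lift_inj _ ord0)) (negPf ij) mul0r raddf0 => /eqP.
by rewrite addr_eq0 => /eqP ->; rewrite opprK.
Qed.

Lemma K_ge1 (r m n : nat) : (0 < r)%N -> (0 < m)%N -> (0 < n)%N -> 1 <= K R r m n.
Proof.
move=> r0 m0 n0; have [[A [[e [e1 AE]] An]] _] := Lambda_min R r m n.
rewrite /K -An ler_pdivlMr ?sqrtr_gt0 ?ltr0n // mul1r AE.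
exact: form_norm_ge.
Qed.

Lemma K_eq1 (r n : nat) : (0 < r)%N -> (0 < n)%N ->
  K R r n n = 1 <->
    (exists H : 'M[int]_n, is_hadamard H) /\ (r <= hurwitz_radon n)%N.
Proof.
move=> r0 n0; have sn : Num.sqrt n%:R != 0 :> R by rewrite sqrtr_eq0 -ltNge ltr0n.
split=> [K1|[[H [H1 HH]] rn]].
  have [[A [[e [e1 AE]] An]] _] := Lambda_min R r n n.
  have nuE : form_norm (triform e) ^+ 2 = n%:R.
    rewrite -AE An -[Lambda R r n n](divfK sn) -[_ / _]/(K R r n n) K1 mul1r.
    by rewrite sqr_sqrtr.
  have rel : hurwitz_relations (slice e) n%:R.
    by apply: small_norm_relations => //; left; rewrite nuE; lra.
  split; last by case: r r0 e e1 rel {K1 A AE An nuE} => // r _ e e1; exact: relations_hurwitz_radon.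
  pose i : 'I_r := Ordinal r0.
  pose H : 'M[int]_n := \matrix_(j, k) if e i j k == 1 then 1 else -1.
  exists H; split=> [j k|]; first by rewrite mxE; case: ifP; [left|right].
  have HE : map_mx intr H = slice e i.
    apply/matrixP => j k; rewrite !mxE; case: eqP => [->//|ne].
    by case: (e1 i j k) => // ->; rewrite rmorphN1.
  have HHR : map_mx intr (H *m H^T) = map_mx intr (n%:R%:M) :> 'M[R]_n.
    rewrite map_mxM -map_trmx HE map_scalar_mx /= rmorph_nat.
    by apply: small_norm_hadamard => //; rewrite nuE; lra.
  apply/matrixP => a b; apply: (@intr_inj R).
  by move/matrixP/(_ a b): HHR; rewrite !mxE.
apply/eqP; rewrite eq_le K_ge1 // andbT /K ler_pdivrMr ?sqrtr_gt0 ?ltr0n // mul1r.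
pose X : 'M[R]_n := map_mx intr H.
have Xs : sign_mx X.
  by move=> i j; rewrite mxE; case: (H1 i j) => ->; [left|right; rewrite rmorphN1].
have XX : X *m X^T = n%:R%:M by rewrite map_trmx -map_mxM HH map_scalar_mx /= rmorph_nat.
have [e [e1 rel]] := hurwitz_relations_exist n0 Xs XX rn.
have [_ le] := Lambda_min R r n n; apply: le_trans (form_norm_relations rel).
by apply: le; exists e.
Qed.

(** A form that is not extremal violates [small_norm_relations], so its squared
norm nu is at least n + 1/2, or at least 2 when n = 1. This is stronger than
the claim, as (1 + 1/(2n))^2 >= 1 + 1/n >= 1 + 2/n^3 for n >= 2. *)
Lemma form_norm_gap (r n : nat) (A : 'rV[R]_r -> 'rV[R]_n -> 'rV[R]_n -> R) :
  (0 < n)%N -> sign_form A -> Num.sqrt n%:R < form_norm A ->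
  (1 + 2 / n%:R ^+ 3) `^ (1 / 4) <= form_norm A / Num.sqrt n%:R.
Proof.
move=> n0 [e [e1 ->]] big; set t := form_norm _ / _.
have np : 0 < n%:R :> R by rewrite ltr0n.
have t0 : 0 <= t by rewrite divr_ge0 ?sqrtr_ge0 ?form_norm_ge0.
set nu := form_norm (triform e) ^+ 2.
have t2 : t ^+ 2 = nu / n%:R by rewrite /t expr_div_n sqr_sqrtr // ltW.
have nubig : ~ (nu < n%:R + 2^-1 \/ n = 1%N /\ nu < n%:R + 1).
  move=> /(small_norm_relations e1) /form_norm_relations.
  by rewrite leNgt big.
suff t4 : 1 + 2 / n%:R ^+ 3 <= t ^+ 4.
  have q0 : 0 <= 1 + 2 / n%:R ^+ 3 :> R by rewrite addr_ge0 // divr_ge0 // exprn_ge0 // ltW.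
  have -> : t = (t ^+ 4) `^ (1 / 4).
    by rewrite -powR_mulrn // -powRrM mul1r mulfV ?pnatr_eq0 // powRr1.
  by apply: ge0_ler_powR => //; rewrite ?nnegrE ?exprn_ge0 // divr_ge0.
have -> : t ^+ 4 = (nu / n%:R) ^+ 2 by rewrite -t2 -exprM.
have [n1|n2] := leqP n 1.
  have nE : n = 1%N by lia.
  have : 2 <= nu.
    rewrite leNgt; apply/negP => lt; apply: nubig; right; split=> //.
    by rewrite nE; lra.
  rewrite nE !expr1n !divr1 => nu2; nra.
have n2' : 2 <= n%:R :> R by rewrite (ler_nat R 2).
have nuge : n%:R + 2^-1 <= nu by rewrite leNgt; apply/negP => lt; apply: nubig; left.
have h : 1 + 2^-1 / n%:R <= nu / n%:R.
  by rewrite ler_pdivlMr // mulrDl mul1r divfK ?gt_eqF.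
set v := n%:R^-1 in h *.
have v0 : 0 < v by rewrite invr_gt0.
have v1 : v <= 2^-1 by rewrite lef_pV2 ?posrE.
have -> : 2 / n%:R ^+ 3 = 2 * v ^+ 3 :> R by rewrite exprVn.
have a : 2 * v ^+ 3 <= v by nra.
nra.
Qed.
End Extremal.

(** * Hadamard matrices of order 2^a 12^b *)

Section Hadamard.
Variable R : numDomainType.

Definition hadamard_order (n : nat) : Prop :=
  exists X : 'M[R]_n, sign_mx X /\ X *m X^T = n%:R%:M.

Lemma hadamard_order1 : hadamard_order 1.
Proof.
exists (const_mx 1); split=> [i j|]; first by rewrite mxE; left.
by apply/matrixP => i j; rewrite !mxE big_ord1 !mxE mulr1 [i]ord1 [j]ord1.
Qed.

Lemma sum_signs (c : nat -> bool) (s : seq nat) :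
  \sum_(k <- s) (-1) ^+ c k + 2 * (count c s)%:R = (size s)%:R :> R.
Proof.
elim: s => [|k s IHs]; first by rewrite big_nil add0r mulr0.
rewrite big_cons /= natrD mulrDr addrACA IHs -[in RHS]natr1 addrC.
by case: (c k); rewrite ?expr1 ?expr0 ?mulr1 ?mulr0 ?addr0 //; congr (_ + _); ring.
Qed.

(** The inner product of two sign rows is n - 2 c, where c counts the places
where they differ. For a matrix given by a table of signs, orthogonality of its
rows is therefore decidable by computation on natural numbers. *)
Lemma hadamard_order_table (n : nat) (b : nat -> nat -> bool) :
  all (fun i => all (fun j => (i == j) || (2 * count (fun k => b i k (+) b j k) (iota 0 n) == n)%N)
    (iota 0 n)) (iota 0 n) -> hadamard_order n.
Proof.
move=> H; exists (\matrix_(i, j) (-1) ^+ b i j); split=> [i j|].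
  by rewrite mxE; case: (b i j); [right|left].
apply/matrixP => i j; rewrite !mxE.
rewrite (eq_bigr (fun k : 'I_n => (-1) ^+ (b i k (+) b j k))); last first.
  by move=> k _; rewrite !mxE signr_addb.
rewrite -(big_mkord xpredT (fun k : nat => (-1) ^+ (b i k (+) b j k))) /index_iota subn0.
have := sum_signs (fun k => b i k (+) b j k) (iota 0 n); rewrite size_iota.
have [<-|ij] := eqVneq i j.
  by rewrite (eq_count (a2 := pred0)) ?count_pred0 ?mulr0 ?addr0 // => k; rewrite /= addbb.
have ii (k : 'I_n) : nat_of_ord k \in iota 0 n by rewrite mem_iota /= ltn_ord.
have := allP (allP H _ (ii i)) _ (ii j); rewrite /= val_eqE (negPf ij) /= => /eqP cn.
by rewrite -[X in (_ + _ = X)]add0r -[X in _ = _ + X%:R]cn natrM => /addIr ->; rewrite mulr0n.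
Qed.

Lemma hadamard_order2 : hadamard_order 2.
Proof. by apply: (@hadamard_order_table 2 (fun i j => (i == 1%N) && (j == 1%N))). Qed.

(** The signs of Paley's matrix I + S, where S is the skew matrix built from the
quadratic character modulo 11; the list gives the nonzero squares. *)
Definition paley12 (i j : nat) : bool :=
  if i == j then false else if i == 0%N then false else if j == 0%N then true
  else ((j + 11 - i) %% 11)%N \notin [:: 1; 3; 4; 5; 9]%N.

Lemma hadamard_order12 : hadamard_order 12.
Proof. by apply: (@hadamard_order_table 12 paley12); vm_compute. Qed.

Lemma hadamard_orderM (m n : nat) :
  hadamard_order m -> hadamard_order n -> hadamard_order (m * n).
Proof.
move=> [X [Xs XX]] [Y [Ys YY]]; exists (tensmx X Y); split.
  move=> i j; case: (mxtens_indexP i) => i0 i1; case: (mxtens_indexP j) => j0 j1.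
  rewrite tensmxE; case: (Xs i0 j0) => ->; case: (Ys i1 j1) => ->;
    rewrite ?mulrNN ?mulr1 ?mul1r; by [left|right].
rewrite trmx_tens tensmx_mul XX YY; apply/matrixP => i j.
case: (mxtens_indexP i) => i0 i1; case: (mxtens_indexP j) => j0 j1.
rewrite tensmxE !mxE (can_eq (@mxtens_indexK _ _)) xpair_eqE.
by case: eqP; case: eqP; rewrite ?mulr0n ?mulr0 ?mul0r // !mulr1n -natrM.
Qed.

Lemma hadamard_order_2_12 (a b : nat) : hadamard_order (2 ^ a * 12 ^ b).
Proof.
apply: hadamard_orderM.
  elim: a => [|a IHa]; first exact: hadamard_order1.
  by rewrite expnS; apply: hadamard_orderM => //; exact: hadamard_order2.
elim: b => [|b IHb]; first exact: hadamard_order1.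
by rewrite expnS; apply: hadamard_orderM => //; exact: hadamard_order12.
Qed.
End Hadamard.

(** * The numbers 2^a 12^b are almost dense in ratio *)

Section Density.
Variable R : realType.

(** A positive exponent of 12 brings in a prime factor 3, so that these numbers
are never powers of 2. *)
Definition ratio (g : R) : Prop := exists p q : nat, (0 < p)%N /\ g = 12 ^+ p / 2 ^+ q.

Lemma two_pow_neq0 q : 2 ^+ q != 0 :> R.
Proof. by rewrite expf_neq0 // pnatr_eq0. Qed.

Lemma ratio_exp g j : ratio g -> (0 < j)%N -> ratio (g ^+ j).
Proof.
move=> [p [q [p0 ->]]] j0; exists (p * j)%N, (q * j)%N; split; first by rewrite muln_gt0 p0.
by rewrite expr_div_n !exprM.
Qed.

Lemma ratio_half g : ratio g -> ratio (g / 2).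
Proof.
move=> [p [q [p0 ->]]]; exists p, q.+1; split=> //.
by rewrite exprSr invfM mulrA.
Qed.

Lemma ratioM g h : ratio g -> ratio h -> ratio (g * h).
Proof.
move=> [p [q [p0 ->]]] [p' [q' [p0' ->]]]; exists (p + p')%N, (q + q')%N.
by split; [rewrite addn_gt0 p0 | rewrite !exprD invfM mulrACA].
Qed.

(** Otherwise 3 would divide a power of 2. *)
Lemma ratio_neq2 g : ratio g -> g != 2.
Proof.
move=> [p [q [p0 ->]]]; apply/eqP => /(congr1 ( *%R^~ (2 ^+ q))).
rewrite divfK ?two_pow_neq0 // -exprS -!natrX => /eqP; rewrite eqr_nat => /eqP e.
have : (3 %| 12 ^ p)%N by rewrite -(prednK p0) expnS dvdn_mulr.
by rewrite e Euclid_dvdX.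
Qed.

(** Bernoulli's inequality. *)
Lemma pow_unbounded (g : R) : 1 < g -> exists j, 2 <= g ^+ j.
Proof.
move=> g1; exists (Num.Def.archi_bound (g - 1)^-1).
have gp : 0 < g - 1 by rewrite subr_gt0.
have bern j : 1 + j%:R * (g - 1) <= g ^+ j.
  elim: j => [|j IHj]; first by rewrite mul0r addr0 expr0.
  rewrite exprS -natr1; have j0 : 0 <= j%:R :> R by rewrite ler0n.
  apply: le_trans (ler_wpM2l (ltW (lt_trans ltr01 g1)) IHj); rewrite -subr_ge0.
  have -> : g * (1 + j%:R * (g - 1)) - (1 + (j%:R + 1) * (g - 1)) = j%:R * (g - 1) ^+ 2 by ring.
  by rewrite mulr_ge0 ?sqr_ge0.
apply: le_trans (bern _).
have ip : 0 <= (g - 1)^-1 by rewrite invr_ge0 ltW.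
have h := ltW (archi_boundP ip).
have := ler_wpM2r (ltW gp) h; rewrite mulVf ?gt_eqF //; lra.
Qed.

Lemma crossing (g : R) : 1 < g -> exists j, g ^+ j < 2 /\ 2 <= g ^+ j.+1.
Proof.
move=> /pow_unbounded ex; case: (ex_minnP ex) => [[|j]]; first by rewrite expr0 => h; exfalso; lra.
move=> h min; exists j; split=> //; rewrite ltNge; apply/negP => /min.
by rewrite ltnn.
Qed.

(** One step of the Euclidean algorithm in multiplicative form. If
g^j < 2 <= g^(j+1), the quotients g^(j+1)/2 and h = 2/g^j have product g, so one
of them is at most sqrt(g). The first is of the required form. If it is the
second, which has its powers of 12 in the denominator, dividing 2 by the last
power of h that stays below 2 gives a number in ]1, h] of the required form. *)
Lemma ratio_refine (g : R) : ratio g -> 1 < g -> g <= 2 ->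
  exists g', [/\ ratio g', 1 < g' & g' ^+ 2 <= g].
Proof.
move=> rg g1 g2; have [j [gj gj1]] := crossing g1.
have gp : 0 < g by exact: lt_trans ltr01 g1.
have j0 : (0 < j)%N.
  by case: j gj gj1 => // _; rewrite expr1 leNgt lt_neqAle ratio_neq2 ?g2.
set u := g ^+ j in gj gj1.
have up : 0 < u by rewrite exprn_gt0.
have u1 : 1 < u by rewrite exprn_egt1 // -lt0n.
have gu : g ^+ j.+1 = g * u by rewrite exprS.
have ru : ratio (u / 2) by apply: ratio_half; exact: ratio_exp.
have h2 : 1 < g * u / 2.
  rewrite ltr_pdivlMr // mul1r lt_neqAle eq_sym -gu gj1 andbT.
  by apply: ratio_neq2; exact: ratio_exp.
have [le|gt] := leP ((g * u / 2) ^+ 2) g.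
  by exists (g * u / 2); split=> //; rewrite -gu; apply: ratio_half; exact: ratio_exp.
pose h1 := 2 / u.
have h11 : 1 < h1 by rewrite /h1 ltr_pdivlMr // mul1r.
(* From here on the second quotient, h1, is the one below sqrt(g). *)
have h1g : h1 * (g * u / 2) = g by rewrite /h1; field; rewrite gt_eqF.
have h1s : h1 ^+ 2 <= g.
  rewrite leNgt; apply/negP => lt.
  have : g * g < h1 ^+ 2 * (g * u / 2) ^+ 2 by apply: ltr_pM => //; apply: ltW.
  by rewrite -exprMn h1g expr2 ltxx.
have [i [hi hi1]] := crossing h11.
have hip : 0 < h1 ^+ i by rewrite exprn_gt0 // (lt_trans ltr01).
have h1p : 0 < h1 by exact: lt_trans ltr01 h11.
exists (2 / h1 ^+ i); split.
- have i0 : (0 < i)%N.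
    by case: i hi hi1 {hip} => // _; rewrite expr1 /h1 ler_pdivlMr // ger_pMr // leNgt u1.
  have -> : 2 / h1 ^+ i = u * (u / 2) ^+ i.-1.
    rewrite -[in LHS](prednK i0) exprS invfM /h1 expr_div_n invf_div expr_div_n.
    have := exprn_gt0 i.-1 up; have : 0 < 2 ^+ i.-1 :> R by rewrite exprn_gt0.
    by move=> a b; field; rewrite !gt_eqF.
  have ruu : ratio u by exact: ratio_exp.
  by case: i.-1 => [|k]; [rewrite expr0 mulr1 | apply: ratioM => //; exact: ratio_exp].
- by rewrite ltr_pdivlMr // mul1r.
apply: le_trans h1s; rewrite ler_sqr ?nnegrE ?divr_ge0 ?(ltW hip) ?(ltW up) //.
by rewrite ler_pdivrMr // -exprS.
Qed.

Lemma ratio_fine k : exists g, [/\ ratio g, 1 < g & g ^+ (2 ^ k) <= 2].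
Proof.
elim: k => [|k [g [rg g1 gk]]].
  by exists (12 / 2 ^+ 3); split; [exists 1%N, 3%N; rewrite expr1 | lra | rewrite expr1; lra].
have g2 : g <= 2 by apply: le_trans gk; rewrite ler_eXnr ?expn_gt0 // ltW.
have [g' [rg' g1' gg]] := ratio_refine rg g1 g2.
exists g'; split=> //; rewrite expnS exprM; apply: le_trans gk.
have g0 : 0 <= g by rewrite ltW // (lt_trans ltr01).
by rewrite lerXn2r ?nnegrE ?sqr_ge0.
Qed.

(** Starting from the largest power 2^a0 that is at most n, multiply by a ratio g close
to 1 until n is reached: the overshoot is at most g. The number of steps is
bounded independently of n, which is why the exponent b stays bounded. *)
Lemma near_orders k : exists B n0 : nat, forall n, (n0 <= n)%N -> (0 < n)%N ->
  exists a b, [/\ (b <= B)%N, (n <= 2 ^ a * 12 ^ b)%N &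
    (2 ^ a * 12 ^ b)%:R ^+ (2 ^ k) <= 2 * n%:R ^+ (2 ^ k) :> R].
Proof.
have [g [[p [q [p0 gE]]] g1 gk]] := ratio_fine k.
have [J gJ] := pow_unbounded g1.
have gp : 0 < g by exact: lt_trans ltr01 g1.
exists (p * J)%N, (2 ^ (q * J))%N => n nbig n0.
have /andP[lo hi] := trunc_log_bounds (isT : (1 < 2)%N) n0.
set a0 := trunc_log 2 n in lo hi.
have a0J : (q * J <= a0)%N by exact: trunc_log_max.
have ex : exists j, n%:R <= 2 ^+ a0 * g ^+ j.
  exists J; apply: le_trans (_ : 2 ^+ a0 * 2 <= _); last by rewrite ler_pM2l ?exprn_gt0.
  by rewrite -exprSr -natrX ler_nat ltnW.
case: (ex_minnP ex) => j jn jmin.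
have jJ : (j <= J)%N.
  apply: jmin; apply: le_trans (_ : 2 ^+ a0 * 2 <= _); last by rewrite ler_pM2l ?exprn_gt0.
  by rewrite -exprSr -natrX ler_nat ltnW.
have qj : (q * j <= a0)%N by apply: leq_trans a0J; rewrite leq_mul2l jJ orbT.
exists (a0 - q * j)%N, (p * j)%N.
have NE : (2 ^ (a0 - q * j) * 12 ^ (p * j))%:R = 2 ^+ a0 * g ^+ j :> R.
  rewrite natrM !natrX gE expr_div_n -!exprM -[in RHS](subnK qj) exprD.
  by field; exact: two_pow_neq0.
split; first by rewrite leq_mul2l jJ orbT.
  by rewrite -(ler_nat R) NE.
rewrite NE; have Ng : 2 ^+ a0 * g ^+ j <= g * n%:R.
  case: j jmin {jn jJ qj NE} => [|j] jmin.
    rewrite expr0 mulr1 -natrX; apply: le_trans (_ : n%:R <= _); first by rewrite ler_nat.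
    by rewrite ler_peMl // ltW.
  rewrite exprS mulrCA ler_pM2l // ltW // ltNge; apply/negP => /jmin.
  by rewrite ltnn.
apply: le_trans (_ : (g * n%:R) ^+ (2 ^ k) <= _).
  by rewrite lerXn2r ?nnegrE // mulr_ge0 ?exprn_ge0 // ltW.
by rewrite exprMn ler_wpM2r ?exprn_ge0.
Qed.
End Density.

(** * Short forms *)

Section Truncation.
Variable R : realType.

Lemma fsq_rowsub1 (m M : nat) (f : 'I_m -> 'I_M) (y : 'rV[R]_m) : injective f ->
  fsq (y *m rowsub f 1%:M) = fsq y.
Proof.
move=> fI; rewrite /fsq frob_mull -mulmxA.
have -> : rowsub f 1%:M *m (rowsub f 1%:M)^T = 1%:M :> 'M[R]_m.
  apply/matrixP => i j; rewrite !mxE (bigD1 (f i)) //= big1 ?addr0 => [|k ki].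
    by rewrite !mxE eqxx mul1r eq_sym (inj_eq fI).
  by rewrite !mxE eq_sym (negPf ki) mul0r.
by rewrite mulmx1.
Qed.

(** A submatrix is the product of the matrix with two coordinate isometries. *)
Lemma opsq_mxsub (m n M N : nat) (f : 'I_m -> 'I_M) (g : 'I_n -> 'I_N) (c : R)
    (A : 'M[R]_(M, N)) : injective f -> injective g ->
  opsq c A -> opsq c (mxsub f g A).
Proof.
move=> fI gI cA y.
have -> : mxsub f g A = rowsub f 1%:M *m A *m (rowsub g 1%:M)^T.
  apply/matrixP => i j; rewrite mul_rowsub_mx mul1mx !mxE (bigD1 (g j)) //= big1 ?addr0 => [|k kj].
    by rewrite !mxE eqxx mulr1.
  by rewrite !mxE eq_sym (negPf kj) mulr0.
have g1 : opsq 1 (rowsub g 1%:M : 'M[R]_(n, N)) by move=> z; rewrite fsq_rowsub1 // mul1r.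
rewrite !mulmxA; apply: le_trans (opsq_tr ler01 g1 _) _; rewrite mul1r.
by apply: le_trans (cA _) _; rewrite fsq_rowsub1.
Qed.

(** Truncate an extremal form of order N. *)
Lemma K_le_hadamard (r m n N : nat) : (0 < N)%N -> (m <= N)%N -> (n <= N)%N ->
  hadamard_order R N -> (r <= hurwitz_radon N)%N ->
  K R r m n <= Num.sqrt N%:R / Num.sqrt n%:R.
Proof.
move=> N0 mN nN [X [Xs XX]] rN.
have [e [e1 rel]] := hurwitz_relations_exist N0 Xs XX rN.
pose e' (i : 'I_r) (j : 'I_m) (k : 'I_n) := e i (widen_ord mN j) (widen_ord nN k).
rewrite /K ler_wpM2r ?invr_ge0 ?sqrtr_ge0 //.
have [_ le] := Lambda_min R r m n; apply: le_trans (_ : form_norm (triform e') <= _).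
  by apply: le; exists e'; split=> // i j k; exact: e1.
apply: form_norm_le; first exact: sqrtr_ge0.
move=> x y; rewrite sqr_sqrtr //.
have -> : pencil (slice e') x = mxsub (widen_ord mN) (widen_ord nN) (pencil (slice e) x).
  by apply/matrixP => j k; rewrite mxE !summxE; apply: eq_bigr => i _; rewrite !mxE.
have wI a b (ab : (a <= b)%N) : injective (widen_ord ab).
  by move=> i j /(congr1 val) /= ij; exact: val_inj.
by apply: opsq_mxsub => // z; rewrite (fsq_pencil _ _ rel).
Qed.

Lemma hurwitz_radon_ge_log (n a : nat) : (0 < n)%N -> (2 ^ a %| n)%N ->
  (2 * a <= hurwitz_radon n)%N.
Proof.
move=> n0; rewrite pfactor_dvdn // /hurwitz_radon => av.
apply: leq_trans (leq_mul (leqnn 2) av) _.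
rewrite {1}(divn_eq (logn 2 n) 4).
have : (logn 2 n %% 4 < 4)%N by rewrite ltn_mod.
move: (logn 2 n %% 4)%N (logn 2 n %/ 4)%N => b q b4.
have : (2 * b <= 2 ^ b)%N by case: b b4 => [|[|[|[|]]]].
lia.
Qed.

Lemma log2_exp (k : nat) : log2 (2 ^+ k : R) = k%:R.
Proof.
rewrite /log2 lnXn // -[ln _ *+ k]mulr_natl mulfK // gt_eqF // ln_gt0 //; lra.
Qed.

Lemma log2_le (x y : R) : 0 < x -> x <= y -> log2 x <= log2 y.
Proof.
move=> x0 xy; rewrite /log2 ler_pM2r; last by rewrite invr_gt0 ln_gt0 //; lra.
by rewrite ler_ln ?posrE // (lt_le_trans x0).
Qed.

(** For n large, [near_orders] gives an order N = 2^a 12^b with N/n close to 1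
and b bounded. Then a differs from log2 n by a bounded amount, so the
Hurwitz-Radon number of N, at least 2 a, exceeds (2 - delta) log2 n. *)
Lemma K_cvg1 (delta : R) (r m : nat -> nat) : 0 < delta < 2 ->
  (forall n : nat, (2 <= n)%N -> (0 < r n)%N) ->
  (forall n : nat, (2 <= n)%N -> (1 <= m n <= n)%N) ->
  (\forall n \near \oo, (r n)%:R <= (2 - delta) * log2 (n%:R : R)) ->
  K R (r n) (m n) n @[n --> \oo] --> (1 : R).
Proof.
move=> /andP[d0 d2] r0 m1 rle; apply/cvgrPdist_le => eps eps0.
(* The 2^k-th power of N/n = (sqrt N / sqrt n)^2 is at most 2. *)
have [k kE] : exists k : nat, 2 <= (1 + eps) ^+ (2 * 2 ^ k).
  have e1 : 1 < 1 + eps by rewrite ltrDl.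
  have [j jE] := pow_unbounded e1.
  exists j; apply: le_trans jE _; apply: ler_weXn2l; first by rewrite lerDl ltW.
  by apply: leq_trans (ltnW (ltn_expl j (isT : (1 < 2)%N))) _; rewrite leq_pmull.
have [B [n0 nearN]] := near_orders R k.
pose L := Num.Def.archi_bound (8 * B%:R / delta).
have LE : 8 * B%:R / delta < L%:R by apply: archi_boundP; rewrite divr_ge0 ?mulr_ge0 // ltW.
near=> n.
have n2 : (2 <= n)%N by near: n; exact: nbhs_infty_ge.
have nn0 : (n0 <= n)%N by near: n; exact: nbhs_infty_ge.
have nL : (2 ^ L <= n)%N by near: n; exact: nbhs_infty_ge.
have rn : (r n)%:R <= (2 - delta) * log2 (n%:R : R) by near: n.
have np : (0 < n)%N by lia.
have nR : 0 < n%:R :> R by rewrite ltr0n.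
have /andP[mn1 mnn] := m1 n n2.
have [a [b [bB nN NE]]] := nearN n nn0 np.
set N := (2 ^ a * 12 ^ b)%N in nN NE.
have N0 : (0 < N)%N by exact: leq_trans np nN.
have logL : L%:R <= log2 (n%:R : R).
  by rewrite -[L%:R]log2_exp; apply: log2_le; rewrite ?exprn_gt0 // -natrX ler_nat.
have loga : log2 (n%:R : R) <= a%:R + 4 * B%:R.
  have -> : a%:R + 4 * B%:R = log2 (2 ^+ (a + 4 * B)) :> R by rewrite log2_exp natrD natrM.
  apply: log2_le => //; rewrite -natrX ler_nat.
  apply: leq_trans nN _; rewrite /N expnD leq_mul2l; apply/orP; right.
  rewrite expnM; apply: leq_trans (_ : (2 ^ 4) ^ b <= _)%N; first by case: (b) => // b'; rewrite leq_exp2r.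
  by rewrite leq_exp2l.
have rN : (r n <= hurwitz_radon N)%N.
  apply: leq_trans (hurwitz_radon_ge_log N0 (dvdn_mulr _ (dvdnn _))).
  rewrite -(ler_nat R) natrM; apply: le_trans rn _.
  have : 8 * B%:R <= delta * log2 n%:R.
    by rewrite -ler_pdivrMl // mulrC; apply: le_trans (ltW LE) logL.
  lra.
have K1 : 1 <= K R (r n) (m n) n by apply: K_ge1 => //; exact: r0.
rewrite distrC ger0_norm ?subr_ge0 // lerBlDr addrC.
have Kle := K_le_hadamard N0 (leq_trans mnn nN) nN (hadamard_order_2_12 R a b) rN.
apply: le_trans Kle _.
have q0 : 0 <= Num.sqrt N%:R / Num.sqrt n%:R :> R by rewrite divr_ge0 ?sqrtr_ge0.
have e0 : 0 <= 1 + eps by rewrite addr_ge0 // ltW.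
rewrite -(@ler_pXn2r _ (2 * 2 ^ k)) ?nnegrE ?muln_gt0 ?expn_gt0 //.
apply: le_trans kE; rewrite exprM expr_div_n !sqr_sqrtr // expr_div_n.
by rewrite ler_pdivrMr ?exprn_gt0.
Unshelve. all: by end_near.
Qed.
End Truncation.

(** * The Hilbert-Schmidt norm *)

Section HilbertSchmidt.
Variable R : rcfType.

Definition hs (m n : nat) (A : 'M[R]_(m, n)) : R := Num.sqrt (fsq A).

Lemma hs_ge0 m n (A : 'M[R]_(m, n)) : 0 <= hs A.
Proof. exact: sqrtr_ge0. Qed.

Lemma hs_sqr m n (A : 'M[R]_(m, n)) : hs A ^+ 2 = fsq A.
Proof. by rewrite sqr_sqrtr ?fsq_ge0. Qed.

Lemma hsN m n (A : 'M[R]_(m, n)) : hs (- A) = hs A.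
Proof. by rewrite /hs fsqN. Qed.

Lemma hs0 m n : hs (0 : 'M[R]_(m, n)) = 0.
Proof. by rewrite /hs /fsq frob0l sqrtr0. Qed.

Lemma frob_hs m n (A B : 'M[R]_(m, n)) : `|frob A B| <= hs A * hs B.
Proof.
rewrite -ler_sqr ?nnegrE ?mulr_ge0 ?hs_ge0 // real_normK ?num_real //.
by rewrite exprMn !hs_sqr frob_CS.
Qed.

Lemma hsD m n (A B : 'M[R]_(m, n)) : hs (A + B) <= hs A + hs B.
Proof.
rewrite -ler_sqr ?nnegrE ?addr_ge0 ?hs_ge0 // hs_sqr fsqD sqrrD !hs_sqr.
rewrite lerD2r lerD2l -[hs A * _ *+ 2]mulr_natl ler_wpM2l //.
exact: le_trans (ler_norm _) (frob_hs _ _).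
Qed.

Lemma hs_mulr m n p (A : 'M[R]_(m, n)) (M : 'M[R]_(n, p)) : opsq 1 M -> hs (A *m M) <= hs A.
Proof. by move=> M1; rewrite ler_sqrt ?fsq_ge0 // (le_trans (fsq_mulr _ M1)) // mul1r. Qed.

Lemma hs_mull m n p (A : 'M[R]_(m, n)) (M : 'M[R]_(p, m)) : opsq 1 M -> hs (M *m A) <= hs A.
Proof. by move=> M1; rewrite ler_sqrt ?fsq_ge0 // (le_trans (fsq_mull _ ler01 M1)) // mul1r. Qed.

Lemma fsq1 n : fsq (1%:M : 'M[R]_n) = n%:R.
Proof. by rewrite /fsq /frob mul1mx trmx1 mxtrace1. Qed.

(** The Hilbert-Schmidt norm dominates the operator norm. *)
Lemma opsq_fsq m n (A : 'M[R]_(m, n)) : opsq (fsq A) A.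
Proof.
move=> y; rewrite fsq_rowE -fsq_tr fsq_rows mulr_suml; apply: ler_sum => j _.
have -> : (y *m A) 0 j = frob y (row j A^T).
  by rewrite frobE big_ord1 !mxE; apply: eq_bigr => k _; rewrite !mxE.
by rewrite mulrC; exact: frob_CS.
Qed.

(** This is |tr(W^T W W)| <= ||W||^3 for the Hilbert-Schmidt norm: a version, for
all W, of the fact that a nonzero orthogonal projection has norm at least 1. *)
Lemma frob_cube n (W : 'M[R]_n) : frob (W *m W) W ^+ 2 <= fsq W ^+ 3.
Proof.
apply: le_trans (frob_CS _ _) _; rewrite exprSr ler_wpM2r ?fsq_ge0 //.
by rewrite expr2; exact: fsq_mulr (@opsq_fsq _ _ W).
Qed.

Lemma frob_tens m n p q (A A' : 'M[R]_(m, n)) (B B' : 'M[R]_(p, q)) :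
  frob (tensmx A B) (tensmx A' B') = frob A A' * frob B B'.
Proof.
rewrite /frob trmx_tens tensmx_mul /mxtrace mulr_sum.
by apply: eq_bigr => i _; rewrite mxE.
Qed.
End HilbertSchmidt.

(** * Words in anticommuting letters *)

Section Words.
Variable (A : pzRingType) (s : nat) (c : 'I_s -> A).
Definition wprod (w : seq 'I_s) : A := foldr (fun i x => c i * x) 1 w.

Lemma wprod_cat u v : wprod (u ++ v) = wprod u * wprod v.
Proof. by elim: u => [|i u IHu] /=; [rewrite mul1r | rewrite IHu mulrA]. Qed.

Definition anticommuting := forall i j, i != j -> anti (c i) (c j).

(** Moving a letter across a word that does not contain it costs one sign per
letter. *)
Lemma wprod_notin i w : anticommuting -> i \notin w ->
  c i * wprod w = (-1) ^+ odd (size w) * (wprod w * c i).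
Proof.
move=> ac; elim: w => [|j w IHw] /=; first by rewrite mulr1 mul1r expr0 mul1r.
rewrite inE negb_or => /andP[ij iw].
rewrite mulrA (ac _ _ ij) mulNr -mulrA IHw //.
rewrite mulrA (_ : c j * (-1) ^+ odd (size w) = (-1) ^+ odd (size w) * c j); last first.
  by case: odd; rewrite ?expr1 ?expr0 ?mulrN1 ?mulN1r ?mulr1 ?mul1r.
by case: odd; rewrite /= ?expr1 ?expr0 ?mulN1r ?mul1r ?mulNr ?opprK !mulrA.
Qed.
End Words.

(** Multiplies the sorted word [t] by the letter [i] on the left. The boolean is
the parity of the number of exchanges; equal letters cancel. *)
Fixpoint insert_letter (s : nat) (i : 'I_s) (t : seq 'I_s) : bool * seq 'I_s :=
  if t is j :: t1 then
    if (i < j)%N then (false, i :: t)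
    else if i == j then (false, t1)
    else let bt := insert_letter i t1 in (~~ bt.1, j :: bt.2)
  else (false, [:: i]).

Fixpoint reduce (s : nat) (w : seq 'I_s) : bool * seq 'I_s :=
  if w is i :: w1 then
    let r := reduce w1 in let t := insert_letter i r.2 in (r.1 (+) t.1, t.2)
  else (false, [::]).

Section Reduce.
Variable s : nat.
Implicit Types (i j : 'I_s) (w t : seq 'I_s).

Let ltI : rel 'I_s := relpre val ltn.

Lemma insert_path i j t : path ltI j t -> (j < i)%N -> path ltI j (insert_letter i t).2.
Proof.
elim: t j => [|k t IHt] j /=; first by move=> _ ji; rewrite andbT.
move=> /andP[jk kt] ji; case: ltnP => [ik|ki] /=; first by apply/and3P.
case: eqVneq => [_|ik] /=; last first.
  by rewrite jk /=; apply: IHt => //; rewrite ltn_neqAle ki andbT eq_sym.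
case: t kt {IHt} => //= l t /andP[kl ->]; rewrite andbT.
exact: ltn_trans kl.
Qed.

Lemma insert_sorted i t : sorted ltI t -> sorted ltI (insert_letter i t).2.
Proof.
case: t => [|k t] //= kt; case: ltnP => [ik|ki] /=; first by apply/andP.
case: eqVneq => [_|ik] /=; first exact: path_sorted kt.
by apply: insert_path => //; rewrite ltn_neqAle ki andbT eq_sym.
Qed.

Lemma reduce_sorted w : sorted ltI (reduce w).2.
Proof. by elim: w => //= i w IHw; exact: insert_sorted. Qed.

Lemma reduce_uniq w : uniq (reduce w).2.
Proof.
apply: (sorted_uniq (leT := ltI)) (reduce_sorted w); first by move=> ? ? ?; exact: ltn_trans.
by move=> i; exact: ltnn.
Qed.

Lemma insert_count i j t :
  odd (count_mem j (insert_letter i t).2) = (i == j) (+) odd (count_mem j t).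
Proof.
elim: t => [|k t IHt] /=; first by rewrite addn0 oddb addbF.
case: ltnP => [ik|ki] /=; first by rewrite !oddD !oddb.
case: eqVneq => [->|ik] /=; first by rewrite oddD oddb addbA addbb.
by rewrite !oddD IHt !oddb addbCA.
Qed.

Lemma reduce_count j w : odd (count_mem j (reduce w).2) = odd (count_mem j w).
Proof. by elim: w => //= i w IHw; rewrite insert_count IHw oddD oddb. Qed.

(** The normal form lists the letters that occur an odd number of times. *)
Lemma reduce_nil w : (reduce w).2 = [::] <-> forall j, ~~ odd (count_mem j w).
Proof.
split=> [w0 j|w0]; first by rewrite -reduce_count w0.
case E: (reduce w).2 => [//|j t].
by have := w0 j; rewrite -reduce_count count_uniq_mem ?reduce_uniq // E mem_head.
Qed.

Lemma insert_size i t : (size (insert_letter i t).2 <= (size t).+1)%N.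
Proof.
elim: t => //= k t IHt; case: ltnP => //= _; case: eqP => //= _.
exact: leq_trans (leqnSn _) (leqnSn _).
Qed.

Lemma reduce_size w : (size (reduce w).2 <= size w)%N.
Proof. by elim: w => //= i w IHw; apply: leq_trans (insert_size _ _) _. Qed.

Lemma insert_exact (A : pzRingType) (c : 'I_s -> A) i t :
  anticommuting c -> (forall i, c i * c i = 1) ->
  c i * wprod c t = (-1) ^+ (insert_letter i t).1 * wprod c (insert_letter i t).2.
Proof.
move=> ac cc; elim: t => [|k t IHt] /=; first by rewrite expr0 mul1r.
case: ltnP => [ik|ki] /=; first by rewrite expr0 mul1r.
case: eqVneq => [->|ik] /=; first by rewrite mulrA cc expr0.
rewrite mulrA (ac _ _ ik) mulNr -mulrA IHt.
by case: (insert_letter i t).1; rewrite /= ?expr1 ?expr0 ?mulN1r ?mul1r ?mulrN ?opprK.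
Qed.

Lemma reduce_exact (A : pzRingType) (c : 'I_s -> A) w :
  anticommuting c -> (forall i, c i * c i = 1) ->
  wprod c w = (-1) ^+ (reduce w).1 * wprod c (reduce w).2.
Proof.
move=> ac cc; elim: w => [|i w IHw] /=; first by rewrite expr0 mul1r.
rewrite IHw; case: (reduce w).1 => /=.
  rewrite expr1 mulN1r mulrN (insert_exact _ _ ac cc).
  by case: (insert_letter _ _).1; rewrite /= ?expr1 ?expr0 ?mulN1r ?mul1r ?opprK.
by rewrite expr0 mul1r (insert_exact _ _ ac cc).
Qed.

(** A word of even length anticommutes with its first letter, and a word of odd
length with any letter that it omits, which exists as the number s of letters is
even. A matrix that anticommutes with an invertible one has trace zero. *)
Lemma trace_uniq_word (F : numFieldType) (n : nat) (c : 'I_s -> 'M[F]_n) t :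
  ~~ odd s -> anticommuting c -> (forall i, c i * c i = 1) ->
  uniq t -> t != [::] -> \tr (wprod c t) = 0.
Proof.
move=> s2 ac cc ut t0.
have [i ai] : exists i, anti (c i) (wprod c t).
  have [od|ev] := boolP (odd (size t)).
    have [i it] : exists i, i \notin t.
      apply/existsP; apply: contraNT s2; rewrite negb_exists => /forallP all_in.
      suff -> : s = size t by [].
      rewrite -[LHS](card_ord s) -(card_uniqP ut); apply: eq_card => i.
      by rewrite inE; apply/esym; have := all_in i; rewrite negbK.
    by exists i; rewrite /anti (wprod_notin ac it) od expr1 mulN1r.
  case: t ut t0 ev => //= i t /andP[it _] _; rewrite negbK => od.
  exists i; rewrite /anti -[X in _ = - X]mulrA.
  have -> : wprod c t * c i = - (c i * wprod c t).
    by rewrite (wprod_notin ac it) od expr1 mulN1r opprK.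
  by rewrite mulrN opprK.
have : \tr (wprod c t) = - \tr (wprod c t).
  rewrite -{1}[wprod c t]mul1r -{1}(cc i) -mulrA ai mulrN -[_ * _]/(_ *m _).
  by rewrite linearN /= mxtrace_mulC -mulmxA -[c i *m c i]/(c i * c i) cc mulmx1.
move=> /eqP; rewrite -addr_eq0 -mulr2n mulrn_eq0 /= => /eqP; exact.
Qed.
End Reduce.

(** * Words in approximately anticommuting letters *)

Section Approximate.
Variables (R : rcfType) (s d : nat) (C : 'I_s -> 'M[R]_d) (delta : R).
Hypothesis C_contr : forall i, opsq 1 (C i).
Hypothesis C_anti : forall i j, i != j -> hs (C i * C j + C j * C i) <= delta.
Hypothesis C_sq : forall i, hs (C i * C i - 1) <= delta.

Lemma delta_ge0 (i : 'I_s) : 0 <= delta.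
Proof. exact: le_trans (hs_ge0 _) (C_sq i). Qed.

Lemma wprod_contr w : opsq 1 (wprod C w).
Proof.
elim: w => [|i w IHw] y /=; first by rewrite mulmx1 mul1r.
rewrite mulmxA; apply: le_trans (IHw _) _; rewrite mul1r.
by apply: le_trans (C_contr i _) _; rewrite mul1r.
Qed.

(** Every exchange or cancellation in the exact computation costs at most
[delta] here, because the remaining letters are contractions. *)
Lemma insert_approx i t :
  hs (C i * wprod C t - (-1) ^+ (insert_letter i t).1 * wprod C (insert_letter i t).2)
  <= (size t)%:R * delta.
Proof.
have d0 := delta_ge0 i.
elim: t => [|k t IHt] /=; first by rewrite expr0 mul1r subrr hs0 mul0r.
case: ltnP => [ik|ki] /=; first by rewrite expr0 mul1r subrr hs0 mulr_ge0.
rewrite -natr1 mulrDl mul1r; case: eqVneq => [->|ik] /=.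
  rewrite expr0 mul1r mulrA -[X in _ - X]mul1r -mulrBl.
  apply: le_trans (hs_mulr _ (wprod_contr t)) _; apply: le_trans (C_sq k) _.
  by rewrite lerDr mulr_ge0.
set b := (insert_letter i t).1 in IHt *; set u := (insert_letter i t).2 in IHt *.
have -> : C i * (C k * wprod C t) - (-1) ^+ (~~ b) * (C k * wprod C u)
  = (C i * C k + C k * C i) * wprod C t - C k * (C i * wprod C t - (-1) ^+ b * wprod C u).
  rewrite mulrDl mulrBr opprB -!mulrA [X in _ = _ + X]addrC addrA addrK.
  by case: (b); rewrite /= ?expr1 ?expr0 ?mulN1r ?mul1r ?mulrN ?opprK.
apply: le_trans (hsD _ _) _; rewrite hsN addrC lerD //.
  exact: le_trans (hs_mull _ (C_contr k)) IHt.
exact: le_trans (hs_mulr _ (wprod_contr t)) (C_anti ik).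
Qed.

Lemma reduce_approx w :
  hs (wprod C w - (-1) ^+ (reduce w).1 * wprod C (reduce w).2) <= (size w)%:R ^+ 2 * delta.
Proof.
elim: w => [|i w IHw] /=; first by rewrite expr0 mul1r subrr hs0 expr0n mul0r.
have d0 := delta_ge0 i.
set b := (reduce w).1 in IHw *; set u := (reduce w).2 in IHw *.
have ins := insert_approx i u.
set b' := (insert_letter i u).1 in ins *; set v := (insert_letter i u).2 in ins *.
have -> : C i * wprod C w - (-1) ^+ (b (+) b') * wprod C v =
   C i * (wprod C w - (-1) ^+ b * wprod C u)
   + (-1) ^+ b * (C i * wprod C u - (-1) ^+ b' * wprod C v).
  rewrite signr_addb !mulrBr !mulrA.
  have -> : C i * (-1) ^+ b = (-1) ^+ b * C i.
    by case: (b); rewrite ?expr1 ?expr0 ?mulrN1 ?mulN1r ?mulr1 ?mul1r.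
  by rewrite addrA subrK.
apply: le_trans (hsD _ _) _.
have hb (X : 'M[R]_d) : hs ((-1) ^+ b * X) = hs X.
  by case: (b); rewrite ?expr1 ?expr0 ?mulN1r ?mul1r ?hsN.
rewrite hb; apply: le_trans (lerD (hs_mull _ (C_contr i)) ins) _.
apply: le_trans (lerD IHw (lexx _)) _; rewrite -mulrDl ler_wpM2r //.
have : (size u)%:R <= (size w)%:R :> R by rewrite ler_nat reduce_size.
have : 0 <= (size w)%:R :> R by [].
rewrite -natr1; nra.
Qed.

Lemma tr_sign (n : nat) (b : bool) : \tr ((-1) ^+ b : 'M[R]_n) = (-1) ^+ b * n%:R.
Proof. by case: b; rewrite ?expr1 ?expr0 ?mulN1r ?mul1r ?linearN /= mxtrace1. Qed.

Variables (D : nat) (e : 'I_s -> 'M[R]_D).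
Hypothesis s_even : ~~ odd s.
Hypothesis e_anti : anticommuting e.
Hypothesis e_sq : forall i, e i * e i = 1.

Lemma word_trace0 w : (reduce w).2 != [::] -> \tr (wprod e w) = 0.
Proof.
move=> w0; rewrite (reduce_exact _ e_anti e_sq).
have := trace_uniq_word s_even e_anti e_sq (reduce_uniq w) w0.
by case: (reduce w).1 => t0; rewrite ?expr1 ?expr0 ?mulN1r ?mul1r ?linearN /= t0 ?oppr0.
Qed.

(** When the word reduces to the empty one, the exact and the approximate product
carry the same sign, which cancels in the product of the traces. *)
Lemma word_trace w : (reduce w).2 = [::] ->
  D%:R * (d%:R - (size w)%:R ^+ 2 * delta * Num.sqrt d%:R)
    <= \tr (wprod C w) * \tr (wprod e w).
Proof.
move=> w0; rewrite (reduce_exact w e_anti e_sq) w0 /= mulr1 tr_sign.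
have := reduce_approx w; rewrite w0 /= mulr1; set b := (reduce w).1 => hE.
set X := wprod C w - _ in hE.
have -> : \tr (wprod C w) = (-1) ^+ b * d%:R + \tr X.
  by rewrite /X linearB /= tr_sign addrC subrK.
have trX : `|\tr X| <= (size w)%:R ^+ 2 * delta * Num.sqrt d%:R.
  have -> : \tr X = frob X 1%:M by rewrite /frob trmx1 mulmx1.
  apply: le_trans (frob_hs _ _) _; rewrite {2}/hs fsq1.
  by rewrite ler_wpM2r ?sqrtr_ge0.
move: trX; rewrite ler_norml => /andP[lo hi].
have D0 : 0 <= D%:R :> R by [].
have -> : ((-1) ^+ b * d%:R + \tr X) * ((-1) ^+ b * D%:R)
  = D%:R * ((-1) ^+ b * ((-1) ^+ b * d%:R + \tr X)) by ring.
rewrite ler_wpM2l //.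
by case: (b); rewrite ?expr1 ?expr0; lra.
Qed.
End Approximate.

Lemma frob_suml (R : realFieldType) (m n : nat) (I : finType) (F : I -> 'M[R]_(m, n)) B :
  frob (\sum_i F i) B = \sum_i frob (F i) B.
Proof. by rewrite /frob mulmx_suml raddf_sum. Qed.

Lemma frob_sumr (R : realFieldType) (m n : nat) (I : finType) (F : I -> 'M[R]_(m, n)) B :
  frob B (\sum_i F i) = \sum_i frob B (F i).
Proof. by rewrite frobC frob_suml; apply: eq_bigr => i _; rewrite frobC. Qed.

Lemma wprod_tr (R : comNzRingType) (n s : nat) (c : 'I_s -> 'M[R]_n) w :
  (forall i, (c i)^T = c i) -> (wprod c w)^T = wprod c (rev w).
Proof.
move=> cT; elim: w => [|i w IHw] /=; first exact: trmx1.
by rewrite rev_cons -cats1 wprod_cat /= mulr1 trmx_mul IHw cT.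
Qed.

(** The operators C_i (x) e_i nearly commute and are nearly involutions. If they were so
exactly, the average over all subsets f of the products of the C_i (x) e_i for i
in f would be a projection, onto their common fixed vectors, of trace d D / 2^s;
a nonzero projection has trace at least 1, so d D >= 2^s. The sum W below is 2^s
times this average. Instead of idempotence, the argument uses the lower bound
[cubic_word_sum] for <W W, W> against ||W||^3. The exact factor e makes the
traces of all words with a letter of odd multiplicity vanish, which is what an
approximate system alone cannot do. *)
Section StabilityBound.
Variables (R : rcfType) (s d D : nat) (C : 'I_s -> 'M[R]_d) (e : 'I_s -> 'M[R]_D) (eta : R).
Hypothesis C_contr : forall i, opsq 1 (C i).
Hypothesis C_sym : forall i, (C i)^T = C i.
Hypothesis C_anti : forall i j, i != j -> hs (C i * C j + C j * C i) <= eta * Num.sqrt d%:R.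
Hypothesis C_sq : forall i, hs (C i * C i - 1) <= eta * Num.sqrt d%:R.
Hypothesis s_even : ~~ odd s.
Hypothesis e_anti : anticommuting e.
Hypothesis e_sq : forall i, e i * e i = 1.
Hypothesis e_sym : forall i, (e i)^T = e i.
Hypotheses (d_gt0 : (0 < d)%N) (D_gt0 : (0 < D)%N) (eta_ge0 : 0 <= eta).
Hypothesis eta_small : 9 * s%:R ^+ 2 * eta <= 1.

Let word (f : {ffun 'I_s -> bool}) : seq 'I_s := [seq i <- enum 'I_s | f i].

Lemma word_count f i : odd (count_mem i (word f)) = f i.
Proof.
rewrite /word count_uniq_mem; last by rewrite filter_uniq // enum_uniq.
rewrite mem_filter mem_enum andbT.
by case: (f i).
Qed.

Lemma word_size f : (size (word f) <= s)%N.
Proof. by rewrite /word size_filter (leq_trans (count_size _ _)) // size_enum_ord. Qed.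

Let T f := tensmx (wprod C (word f)) (wprod e (word f)).
Let W := \sum_f T f.

Lemma frob_wprod (n : nat) (c : 'I_s -> 'M[R]_n) u v : (forall i, (c i)^T = c i) ->
  frob (wprod c u) (wprod c v) = \tr (wprod c (u ++ rev v)).
Proof. by move=> cT; rewrite /frob wprod_tr // wprod_cat. Qed.

Lemma card_signs : #|{ffun 'I_s -> bool}| = (2 ^ s)%N.
Proof. by rewrite card_ffun card_bool card_ord. Qed.

Lemma sum_signs_const (x : R) : \sum_(f : {ffun 'I_s -> bool}) x = (2 ^ s)%:R * x.
Proof. by rewrite sumr_const card_signs mulr_natl. Qed.

(** Distinct subsets give orthogonal terms. *)
Lemma fsq_word_sum : fsq W <= (2 ^ s)%:R * (d%:R * D%:R).
Proof.
have e_contr i : opsq 1 (e i).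
  by move=> y; rewrite /fsq frob_mull -mulmxA e_sym -[e i *m e i]/(e i * e i) e_sq mulmx1 mul1r.
have c1 n (c : 'I_s -> 'M[R]_n) w : (forall i, opsq 1 (c i)) -> fsq (wprod c w) <= n%:R.
  move=> cc; rewrite -fsq1 -[wprod c w]mul1mx.
  by apply: le_trans (fsq_mulr _ (wprod_contr cc w)) _; rewrite mul1r.
rewrite /fsq frob_suml -sum_signs_const; apply: ler_sum => f _; rewrite frob_sumr (bigD1 f) //= big1 ?addr0 => [|g gf].
  by rewrite frob_tens ler_pM ?fsq_ge0 ?c1.
rewrite frob_tens [X in _ * X]frob_wprod // word_trace0 ?mulr0 //.
apply: contra_neq gf => /reduce_nil w0; apply/ffunP => i.
have := w0 i; rewrite count_cat count_rev oddD !word_count.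
by case: (f i); case: (g i).
Qed.

(** Each pair of subsets f, g contributes the term of their symmetric
difference, which is almost d D; the remaining terms are zero. *)
Lemma cubic_word_sum :
  (2 ^ s)%:R ^+ 2 * (d%:R * D%:R * (1 - 9 * s%:R ^+ 2 * eta)) <= frob (W *m W) W.
Proof.
have termE f g h : frob (T f *m T g) (T h) =
    \tr (wprod C ((word f ++ word g) ++ rev (word h))) *
    \tr (wprod e ((word f ++ word g) ++ rev (word h))).
  by rewrite tensmx_mul frob_tens -!frob_wprod // !wprod_cat.
have bound w : (size w <= 3 * s)%N -> (reduce w).2 = [::] ->
    d%:R * D%:R * (1 - 9 * s%:R ^+ 2 * eta) <= \tr (wprod C w) * \tr (wprod e w).
  move=> ws w0; apply: le_trans (word_trace C_contr C_anti C_sq e_anti e_sq w0).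
  have -> : (size w)%:R ^+ 2 * (eta * Num.sqrt d%:R) * Num.sqrt d%:R
     = (size w)%:R ^+ 2 * (eta * d%:R) :> R.
    by rewrite -mulrA -mulrA -expr2 sqr_sqrtr.
  have -> : d%:R * D%:R * (1 - 9 * s%:R ^+ 2 * eta)
     = D%:R * (d%:R * (1 - 9 * s%:R ^+ 2 * eta)) by ring.
  rewrite ler_wpM2l //.
  have : (size w)%:R ^+ 2 <= 9 * s%:R ^+ 2 :> R.
    have -> : 9 * s%:R ^+ 2 = (3 * s)%:R ^+ 2 :> R by rewrite natrM exprMn; ring.
    by rewrite ler_sqr ?nnegrE // ler_nat.
  have : 0 <= eta * d%:R by rewrite mulr_ge0.
  nra.
have sz f g h : (size ((word f ++ word g) ++ rev (word h)) <= 3 * s)%N.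
  by rewrite !size_cat size_rev; have := word_size f; have := word_size g; have := word_size h; lia.
have b0 : 0 <= d%:R * D%:R * (1 - 9 * s%:R ^+ 2 * eta).
  by rewrite !mulr_ge0 // subr_ge0.
rewrite mulmx_suml frob_suml expr2 -mulrA -sum_signs_const.
apply: ler_sum => f _; rewrite mulmx_sumr frob_suml -sum_signs_const.
apply: ler_sum => g _; rewrite frob_sumr.
rewrite (bigD1 [ffun i => f i (+) g i]) //= ler_wpDr //.
  apply: sumr_ge0 => h _; rewrite termE.
  have [w0|w0] := eqVneq (reduce ((word f ++ word g) ++ rev (word h))).2 [::].
    by apply: le_trans b0 _; exact: bound.
  by rewrite [X in _ * X]word_trace0 // mulr0.
rewrite termE; apply: bound => //; apply/reduce_nil => i.
by rewrite !count_cat count_rev !oddD !word_count ffunE addbb.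
Qed.

(** Compare 4^s d D (1 - 9 s^2 eta) <= <W W, W> with ||W||^2 <= 2^s d D through
[frob_cube]. *)
Lemma stability_bound : (1 - 9 * s%:R ^+ 2 * eta) ^+ 2 * (2 ^ s)%:R <= d%:R * D%:R.
Proof.
set q := 1 - _; set N := (2 ^ s)%:R; set M := d%:R * D%:R.
have M0 : 0 < M by rewrite mulr_gt0 ?ltr0n.
have N0 : 0 < N by rewrite ltr0n expn_gt0.
have q0 : 0 <= q by rewrite subr_ge0.
have h : (N ^+ 2 * (M * q)) ^+ 2 <= (N * M) ^+ 3.
  apply: le_trans (_ : frob (W *m W) W ^+ 2 <= _).
    rewrite ler_sqr ?nnegrE ?cubic_word_sum // ?mulr_ge0 ?sqr_ge0 ?(ltW M0) //.
    apply: le_trans cubic_word_sum; by rewrite !mulr_ge0 ?(ltW N0) ?(ltW M0).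
  apply: le_trans (frob_cube W) _.
  by rewrite lerXn2r ?nnegrE ?fsq_ge0 ?mulr_ge0 ?(ltW N0) ?(ltW M0) ?fsq_word_sum.
have k0 : 0 < N ^+ 3 * M ^+ 2 by rewrite mulr_gt0 ?exprn_gt0.
rewrite -(ler_pM2l k0); move: h; congr (_ <= _); ring.
Qed.
End StabilityBound.

(** * Exact symmetric Clifford systems *)

Section Positive.
Variable R : comNzRingType.

(** Tensoring the elements of square -1 with a rotation by a right angle changes
their squares to 1. *)
Lemma clifford_positive (n : nat) (sg : seq bool) : signed_clifford R n sg ->
  signed_clifford R (n + n) (nseq (size sg) false).
Proof.
case=> es [<- GE sq pw].
pose J (a : bool * 'M[R]_n) : 'M[R]_(n + n) :=
  if a.1 then block_mx 0 (- a.2) a.2 0 else block_mx a.2 0 0 a.2.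
exists [seq (false, J a) | a <- es]; split.
- by rewrite -map_comp size_map; elim: (es) => //= a l ->.
- move=> a /mapP[[[] x] xin ->] /=; have Gx := GE _ xin.
    by apply: sign_isometry_antidiag => //; exact: sign_isometryN.
  exact: sign_isometry_diag.
- rewrite all_map; apply/allP => -[b x] xin /=.
  have /= /eqP xx := allP sq _ xin.
  rewrite expr0 /J; apply/eqP; rewrite -[_ * _]/(_ *m _) -[1]/(1%:M) scalar_mx_block.
  case: b xx {xin} => xx /=; rewrite mulmx_block !(mulmx0, mul0mx) ?(addr0, add0r).
    by rewrite mulNmx mulmxN -[x *m x]/(x * x) xx expr1 opprK.
  by rewrite -[x *m x]/(x * x) xx expr0.
rewrite pairwise_map; apply: sub_pairwise pw => -[b x] [b' y] /= /eqP xy.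
apply/eqP; rewrite /J -[_ * _]/(_ *m _) -[X in _ = - X]/(_ *m _).
have xy' : x *m y = - (y *m x) by exact: xy.
by case: b; case: b'; rewrite /= !mulmx_block !(mulmx0, mul0mx) ?(addr0, add0r) opp_block_mx
  ?oppr0 ?(mulmxN, mulNmx) xy' ?opprK.
Qed.

Lemma symmetric_clifford (k : nat) : exists e : 'I_(2 * k) -> 'M[R]_(2 ^ k.+1),
  [/\ anticommuting e, (forall i, e i * e i = 1) & (forall i, (e i)^T = e i)].
Proof.
have := clifford_positive (signed_clifford_pow2 R k).
have -> : size (flatten (nseq k [:: false; true])) = (2 * k)%N.
  by elim: k => //= k ->; rewrite mulnS.
have -> : (2 ^ k + 2 ^ k = 2 ^ k.+1)%N by rewrite addnn -mul2n expnS.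
case=> es [sE GE sq pw].
have sz : size es = (2 * k)%N by rewrite -(size_map fst) sE size_nseq.
pose e0 : bool * 'M[R]_(2 ^ k.+1) := (false, 0).
have mem (i : 'I_(2 * k)) : nth e0 es i \in es by apply: mem_nth; rewrite sz.
have e1 (i : 'I_(2 * k)) : (nth e0 es i).2 * (nth e0 es i).2 = 1.
  rewrite (eqP (allP sq _ (mem i))) -(nth_map _ false) ?sz // sE nth_nseq ltn_ord.
  exact: expr0.
exists (fun i => (nth e0 es i).2); split=> // [i j ij|i].
  have ltA (a b : 'I_(2 * k)) : (a < b)%N -> anti (nth e0 es a).2 (nth e0 es b).2.
    by move=> ab; apply/antiP; apply: (pairwiseP e0 pw) => //; rewrite inE sz.
  case: (ltngtP i j) => [|ji|/val_inj eij]; first exact: ltA.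
    by apply: antiC; exact: ltA.
  by rewrite eij eqxx in ij.
have [PP _] := GE _ (mem i).
have := congr1 (mulmx (nth e0 es i).2) PP.
by rewrite mulmxA -[_ *m (nth e0 es i).2]/(_ * _) e1 mul1mx mulmx1.
Qed.
End Positive.

(** * Anticommutation defects of contractions *)

Section Defect.
Variable R : realFieldType.

(** For P = c - N N^T, which is positive, c tr P - tr P^2 = tr(P N N^T) is
nonnegative. *)
Lemma gram_defect (n : nat) (c : R) (N : 'M[R]_n) : 0 <= c -> opsq c N ->
  fsq (c%:M - N *m N^T) <= c * (c * n%:R - fsq N).
Proof.
move=> c0 cN; set G := N *m N^T.
have GT : G^T = G by rewrite trmx_mul trmxK.
have trG : frob c%:M G = c * fsq N.
  by rewrite /frob GT mul_scalar_mx mxtraceZ.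
have GG : fsq G <= c * fsq N.
  have -> : fsq G = fsq (N^T *m N).
    rewrite /fsq /frob GT /G trmx_mul trmxK -!mulmxA mxtrace_mulC.
    by rewrite !mulmxA.
  by apply: le_trans (fsq_mulr _ cN) _; rewrite fsq_tr.
have cc : fsq (c%:M : 'M[R]_n) = c ^+ 2 * n%:R.
  by rewrite /fsq /frob tr_scalar_mx -scalar_mxM mxtrace_scalar expr2 mulr_natr.
rewrite fsqB trG cc; lra.
Qed.

(** The anticommutator is half the difference of the defects 2 - N N^T for
N = A - B and N = A + B. In the sum of the two bounds of [gram_defect] the inner
products of A and B cancel. *)
Lemma anticomm_defect (n : nat) (A B : 'M[R]_n) : opsq 2 (A + B) -> opsq 2 (A - B) ->
  fsq (A *m B^T + B *m A^T) <= 2 * (2 * n%:R - fsq A - fsq B).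
Proof.
move=> hp hm; have two : (0 : R) <= 2 by [].
have dp := gram_defect two hp; have dm := gram_defect two hm.
set X := 2%:M - _ in dp; set Y := 2%:M - _ in dm.
have YX : Y - X = 2 *: (A *m B^T + B *m A^T).
  have tD : (A + B)^T = A^T + B^T by rewrite linearD.
  have tB : (A - B)^T = A^T - B^T by rewrite linearB.
  rewrite /X /Y tD tB !mulmxDl !mulmxDr !mulNmx !mulmxN opprK.
  set a := A *m A^T; set b := B *m B^T; set p := A *m B^T; set q := B *m A^T.
  by apply/matrixP => i j; rewrite !mxE; ring.
have := fsqB Y X; have := fsqD Y X; rewrite YX fsqZ.
have := fsq_ge0 (Y + X).
move: dp dm; rewrite fsqD fsqB; lra.
Qed.

Lemma fsq_row_mx (m n1 n2 : nat) (A : 'M[R]_(m, n1)) (B : 'M[R]_(m, n2)) :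
  fsq (row_mx A B) = fsq A + fsq B.
Proof. by rewrite /fsq /frob tr_row_mx mul_row_col raddfD. Qed.

Lemma fsq_diag_block (n : nat) (A B : 'M[R]_n) : fsq (block_mx A 0 0 B) = fsq A + fsq B.
Proof.
by rewrite /fsq /frob tr_block_mx mulmx_block !trmx0 !(mulmx0, mul0mx) !(addr0, add0r) mxtrace_block.
Qed.

(** Relations between the products A B^T and A^T B become relations between
products of symmetric matrices. *)
Definition selfadjoint_dilation (n : nat) (B : 'M[R]_n) : 'M[R]_(n + n) :=
  block_mx 0 B B^T 0.

Lemma dilation_tr n (B : 'M[R]_n) : (selfadjoint_dilation B)^T = selfadjoint_dilation B.
Proof. by rewrite /selfadjoint_dilation tr_block_mx !trmx0 trmxK. Qed.

Lemma dilation_mul n (A B : 'M[R]_n) :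
  selfadjoint_dilation A * selfadjoint_dilation B = block_mx (A *m B^T) 0 0 (A^T *m B).
Proof. by rewrite -[LHS]/(_ *m _) mulmx_block !(mulmx0, mul0mx) !(addr0, add0r). Qed.

Lemma dilation_contr n (B : 'M[R]_n) : opsq 1 B -> opsq 1 (selfadjoint_dilation B).
Proof.
move=> cB y; rewrite -[y]hsubmxK mul_row_block !mulmx0 add0r addr0 !fsq_row_mx mulrDr addrC.
by rewrite lerD //; exact: opsq_tr ler01 cB _.
Qed.

Lemma dilation_anti n (A B : 'M[R]_n) : opsq 2 (A + B) -> opsq 2 (A - B) ->
  fsq (selfadjoint_dilation A * selfadjoint_dilation B
     + selfadjoint_dilation B * selfadjoint_dilation A)
  <= 4 * (2 * n%:R - fsq A - fsq B).
Proof.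
move=> hp hm; rewrite !dilation_mul add_block_mx !addr0 fsq_diag_block.
have two : (0 : R) <= 2 by [].
have tp : opsq 2 (A^T + B^T) by rewrite -linearD; exact: opsq_tr.
have tm : opsq 2 (A^T - B^T) by rewrite -linearB; exact: opsq_tr.
have := anticomm_defect tp tm; rewrite !trmxK !fsq_tr.
have := anticomm_defect hp hm; lra.
Qed.

Lemma dilation_sq n (B : 'M[R]_n) : opsq 1 B ->
  fsq (selfadjoint_dilation B * selfadjoint_dilation B - 1) <= 2 * (n%:R - fsq B).
Proof.
move=> cB; rewrite dilation_mul -fsqN opprB -[1]/(1%:M) scalar_mx_block opp_block_mx add_block_mx.
rewrite !oppr0 !addr0 fsq_diag_block.
have := gram_defect ler01 cB; have := gram_defect ler01 (opsq_tr ler01 cB).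
rewrite !trmxK !fsq_tr; lra.
Qed.
End Defect.

(** * Long forms *)

Section LowerBound.
Variable R : realType.

(** Divided by the norm of the form, the slices B_i have contractive pencils
and squared Hilbert-Schmidt norm n (1 - kappa) with kappa = 1 - n/nu. The
dilations of the first s = 2 k slices then form a system in order d = 2 n with
anticommutators of size O(sqrt(kappa d)). Exact systems of s symmetric matrices
exist in order D = 2^(k+1), and d D / 2^s = 4 n / 2^k <= 1/2. This contradicts
[stability_bound] if kappa is below a small multiple of s^(-4). *)
Lemma norm_defect (r n k : nat) (e : 'I_r -> 'I_n -> 'I_n -> R) :
  (forall i j l, e i j l = 1 \/ e i j l = -1) ->
  (0 < n)%N -> (2 * k <= r)%N -> (0 < k)%N -> (8 * n <= 2 ^ k)%N ->
  n%:R < form_norm (triform e) ^+ 2 * (1 - ((72 * (2 * k)%:R ^+ 2) ^+ 2)^-1).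
Proof.
move=> e1 n0 kr k0 nk; set nu := form_norm (triform e) ^+ 2.
have r0 : (0 < r)%N by lia.
have nR : 0 < n%:R :> R by rewrite ltr0n.
have nuge : n%:R <= nu := form_norm_sqr_ge e1 r0 n0.
have nup : 0 < nu by exact: lt_le_trans nuge.
have Fp : 0 < form_norm (triform e).
  by rewrite lt_def form_norm_ge0 andbT; apply: contraTneq nup => F0; rewrite /nu F0 expr0n ltxx.
set s := (2 * k)%N; rewrite ltNge; apply/negP => small.
have sR : 0 < s%:R :> R by rewrite ltr0n /s; lia.
(* With this value the loss 9 s^2 eta is 1/4, and (1 - 1/4)^2 > 1/2. *)
pose eta : R := (36 * s%:R ^+ 2)^-1.
have eta0 : 0 <= eta by rewrite invr_ge0 mulr_ge0 ?sqr_ge0.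
pose B (i : 'I_s) : 'M[R]_n := (form_norm (triform e))^-1 *: slice e (widen_ord kr i).
have Bcontr (x : 'rV[R]_r) (y : 'rV[R]_n) : fsq (y *m ((form_norm (triform e))^-1 *: pencil (slice e) x)) <= fsq x * fsq y.
  rewrite -scalemxAr fsqZ exprVn -/nu ler_pdivrMl // mulrA.
  exact: form_norm_pencil.
have B1 i : opsq 1 (B i).
  move=> y; have := Bcontr (delta_mx 0 (widen_ord kr i)) y.
  by rewrite pencil_delta fsq_delta.
have wI : injective (widen_ord kr) by move=> i j /(congr1 val) /= ij; exact: val_inj.
have B2 (t : R) i j : t ^+ 2 = 1 -> i != j -> opsq 2 (B i + t *: B j).
  move=> t1 ij y.
  have := Bcontr (delta_mx 0 (widen_ord kr i) + t *: delta_mx 0 (widen_ord kr j)) y.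
  rewrite pencilD pencilZ !pencil_delta fsqD fsqZ frobZr !fsq_delta t1.
  have -> : frob (delta_mx 0 (widen_ord kr i) : 'rV[R]_r) (delta_mx 0 (widen_ord kr j)) = 0.
    rewrite frobE big_ord1 big1 // => l _; rewrite !mxE eqxx /=.
    by case: eqP => [->|_]; rewrite ?mul0r // (inj_eq wI) (negPf ij) mulr0.
  by rewrite scalerDr scalerA mulrC -scalerA mulr0 mulr0 addr0 mulr1.
have fB i : fsq (B i) = n%:R * (n%:R / nu).
  rewrite /B fsqZ exprVn -/nu fsq_rows (eq_bigr (fun=> n%:R)) => [|j _]; last exact: row_slice.
  by rewrite sumr_const card_ord -mulr_natr; ring.
have kap : 1 - n%:R / nu <= ((72 * s%:R ^+ 2) ^+ 2)^-1.
  by rewrite lerBlDr -lerBlDl ler_pdivlMr // mulrC.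
have kapE : 4 * ((72 * s%:R ^+ 2) ^+ 2)^-1 = eta ^+ 2.
  by rewrite /eta; field; rewrite gt_eqF.
have hsle (M : 'M[R]_(n + n)) : fsq M <= 8 * (n%:R * (1 - n%:R / nu)) ->
    hs M <= eta * Num.sqrt (n + n)%:R.
  move=> Mle; rewrite -ler_sqr ?nnegrE ?hs_ge0 ?mulr_ge0 ?sqrtr_ge0 //.
  rewrite hs_sqr exprMn sqr_sqrtr // -kapE natrD; apply: le_trans Mle _.
  have := ler_wpM2l (ltW nR) kap; lra.
have [ee [ea es eT]] := symmetric_clifford R k.
have m1 : (-1 : R) ^+ 2 = 1 by rewrite sqrrN expr1n.
have := @stability_bound R s (n + n) (2 ^ k.+1) (fun i => selfadjoint_dilation (B i)) ee eta.
have sev : ~~ odd s by rewrite /s oddM.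
have c36 : 9 * s%:R ^+ 2 * eta = 4^-1 by rewrite /eta; field; rewrite gt_eqF.
move=> /(_ (fun i => dilation_contr (B1 i)) (fun i => dilation_tr (B i))).
have Ca (i j : 'I_s) : i != j ->
    hs (selfadjoint_dilation (B i) * selfadjoint_dilation (B j)
      + selfadjoint_dilation (B j) * selfadjoint_dilation (B i)) <= eta * Num.sqrt (n + n)%:R.
  move=> ij; apply: hsle; apply: le_trans (dilation_anti _ _) _.
  - by have := B2 1 i j (expr1n _ _) ij; rewrite scale1r.
  - by have := B2 (-1) i j m1 ij; rewrite scaleN1r.
  by rewrite !fB; lra.
have Cs (i : 'I_s) : hs (selfadjoint_dilation (B i) * selfadjoint_dilation (B i) - 1)
    <= eta * Num.sqrt (n + n)%:R.
  apply: hsle; apply: le_trans (dilation_sq (B1 i)) _; rewrite fB.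
  have : 0 <= n%:R * (1 - n%:R / nu).
    by rewrite mulr_ge0 // subr_ge0 ler_pdivrMr // mul1r.
  lra.
have nn0 : (0 < n + n)%N by rewrite addn_gt0 n0.
have D0 : (0 < 2 ^ k.+1)%N by rewrite expn_gt0.
move=> /(_ Ca Cs sev ea es eT nn0 D0 eta0); rewrite c36 => bnd.
have q1 : 4^-1 <= 1 :> R by lra.
move: {bnd} (bnd q1); set x : R := (2 ^ k)%:R.
have -> : (2 ^ s)%:R = x ^+ 2 :> R by rewrite /s mulnC expnM natrX.
have -> : (2 ^ k.+1)%:R = 2 * x :> R by rewrite expnS natrM.
have nx : 8 * n%:R <= x by rewrite -natrM ler_nat.
have x0 : 0 < x by rewrite ltr0n expn_gt0.
have : x * (8 * n%:R) <= x * x by rewrite ler_pM2l.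
have : 0 < x * x by rewrite mulr_gt0.
rewrite natrD expr2; lra.
Qed.

(** Use [norm_defect] with k the ceiling of log2 (8 n), so that the number of
slices 2 k is at most 8 (1 + log2 n). *)
Lemma K_lower_bound : exists c : R, 0 < c /\
  forall r n : nat, (0 < r)%N -> (0 < n)%N ->
    2 * Num.ceil (log2 (8 * n%:R : R)) <= r%:Z ->
    1 + c / (1 + log2 n%:R) ^+ 4 <= K R r n n.
Proof.
(* If K < 1 + q with 3 q <= w = 1/(72 s^2)^2, then K^2 (1 - w) is at most
     (1 + q)^2 (1 - 3 q) <= 1, against [norm_defect]; and s <= 8 (1 + log2 n). *)
pose c0 : R := 3 * (72 * 8 ^+ 2) ^+ 2.
have c0p : 0 < c0 by rewrite mulr_gt0 ?exprn_gt0 ?mulr_gt0 ?exprn_gt0 ?ltr0n.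
exists c0^-1; split; first by rewrite invr_gt0.
move=> r n r0 n0 rbig.
have nR : 0 < n%:R :> R by rewrite ltr0n.
have n1 : 1 <= n%:R :> R by rewrite ler1n.
have ln2 : 0 < ln 2 :> R by rewrite ln_gt0 //; lra.
have L0 : 0 <= log2 n%:R :> R by rewrite /log2 divr_ge0 ?(ltW ln2) ?ln_ge0.
have log8 : log2 (8 * n%:R : R) = 3 + log2 n%:R.
  have -> : 8 * n%:R = 2 ^+ 3 * n%:R :> R by congr (_ * _); ring.
  rewrite /log2 lnM ?posrE ?exprn_gt0 // mulrDl -/(log2 (2 ^+ 3)) log2_exp.
  by [].
set L := log2 n%:R in L0 log8 *.
pose z := Num.ceil (log2 (8 * n%:R : R)).
have z3 : 3 + L <= z%:~R by rewrite -log8; exact: ceil_ge.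
have z4 : z%:~R < 3 + L + 1 by have := ceilB1_lt (log2 (8 * n%:R : R)); rewrite -/z rmorphB /= log8; lra.
have z0 : 0 <= z by rewrite -(ler_int R); lra.
pose k := `|z|%N; have kz : k%:Z = z by rewrite /k gez0_abs.
have kR : k%:R = z%:~R :> R by rewrite -kz.
have k0 : (0 < k)%N by rewrite -(ltr_nat R) kR; lra.
have kr : (2 * k <= r)%N by move: rbig; rewrite -/z -kz; lia.
have nk : (8 * n <= 2 ^ k)%N.
  rewrite -(ler_nat R) natrM natrX -ler_ln ?posrE ?mulr_gt0 ?exprn_gt0 //.
  rewrite -(ler_pM2r (_ : 0 < (ln 2)^-1)) ?invr_gt0 //.
  rewrite -/(log2 (8 * n%:R)) -/(log2 (2 ^+ k)) log2_exp log8 kR; exact: z3.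
have [[A [[e [e1 AE]] An]] _] := Lambda_min R r n n.
have := norm_defect e1 n0 kr k0 nk; rewrite -AE.
have K1 : 1 <= K R r n n by exact: K_ge1.
have sn : 0 < Num.sqrt n%:R :> R by rewrite sqrtr_gt0.
have -> : form_norm A = K R r n n * Num.sqrt n%:R by rewrite An /K divfK // gt_eqF.
rewrite exprMn sqr_sqrtr ?(ltW nR) // => def.
set kap := K R r n n in K1 def *.
set s : R := (2 * k)%:R in def.
have sL : s <= 8 * (1 + L) by rewrite /s natrM kR; lra.
have s1 : 1 <= s by rewrite /s natrM kR; lra.
have M0 : 0 < 1 + L by lra.
have M4 : 0 < (1 + L) ^+ 4 by rewrite exprn_gt0.
pose t : R := 72 * s ^+ 2.
have t1 : 1 <= t.
  have : 1 <= s ^+ 2 by rewrite exprn_ege1.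
  by rewrite /t; lra.
have tM : t ^+ 2 <= (72 * (8 * (1 + L)) ^+ 2) ^+ 2.
  have sM : s ^+ 2 <= (8 * (1 + L)) ^+ 2 by rewrite lerXn2r ?nnegrE //; lra.
  rewrite /t lerXn2r ?nnegrE ?mulr_ge0 ?sqr_ge0 ?ler0n ?(ltW M0) //.
  by rewrite ler_wpM2l ?ler0n.
set q := c0^-1 / _.
have q0 : 0 < q by rewrite divr_gt0 // invr_gt0.
have t0 : 0 < t ^+ 2 by rewrite exprn_gt0 // (lt_le_trans ltr01).
have qs : 3 * q * t ^+ 2 <= 1.
  have c1 : c0 * (q * (1 + L) ^+ 4) = 1 by rewrite /q divfK ?mulfV // gt_eqF.
  rewrite -[X in _ <= X]c1; have -> : c0 * (q * (1 + L) ^+ 4) = 3 * q * (72 * (8 * (1 + L)) ^+ 2) ^+ 2.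
    by rewrite /c0; ring.
  by rewrite ler_wpM2l // mulr_ge0 ?ler0n ?(ltW q0).
pose w : R := (t ^+ 2)^-1.
have wq : 3 * q <= w by rewrite /w -(ler_pM2r t0) mulVf ?gt_eqF.
have w1 : w <= 1 by rewrite invf_le1 // exprn_ege1.
rewrite leNgt; apply/negP => lt.
have {}def : 1 < kap ^+ 2 * (1 - w).
  by rewrite -(ltr_pM2r nR) mul1r mulrAC.
have k2 : kap ^+ 2 <= (1 + q) ^+ 2 by rewrite lerXn2r ?nnegrE //; lra.
have q1 : 0 <= 1 - 3 * q by lra.
have : kap ^+ 2 * (1 - w) <= (1 + q) ^+ 2 * (1 - 3 * q).
  by apply: ler_pM; rewrite ?sqr_ge0 //; lra.
have -> : (1 + q) ^+ 2 * (1 - 3 * q) = 1 - q - 5 * q ^+ 2 - 3 * q ^+ 3 by ring.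
have : 0 <= q ^+ 2 by rewrite sqr_ge0.
have : 0 <= q ^+ 3 by rewrite exprn_ge0 // ltW.
lra.
Qed.
End LowerBound.

Theorem theorem1 (R : realType) :
  [/\ (forall r n : nat, (0 < r)%N -> (0 < n)%N ->
        (K R r n n = 1 <->
           (exists H : 'M[int]_n, is_hadamard H) /\ (r <= hurwitz_radon n)%N) /\
        (forall A : 'rV[R]_r -> 'rV[R]_n -> 'rV[R]_n -> R,
           sign_form A -> Num.sqrt n%:R < form_norm A ->
           (1 + 2 / n%:R ^+ 3) `^ (1 / 4) <= form_norm A / Num.sqrt n%:R)),
      (forall (delta : R) (r m : nat -> nat), 0 < delta < 2 ->
        (forall n : nat, (2 <= n)%N -> (0 < r n)%N) ->
        (forall n : nat, (2 <= n)%N -> (1 <= m n <= n)%N) ->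
        (\forall n \near \oo, (r n)%:R <= (2 - delta) * log2 (n%:R : R)) ->
        K R (r n) (m n) n @[n --> \oo] --> (1 : R)) &
      (exists c : R, 0 < c /\
        forall r n : nat, (0 < r)%N -> (0 < n)%N ->
          2 * Num.ceil (log2 (8 * n%:R : R)) <= r%:Z ->
          1 + c / (1 + log2 n%:R) ^+ 4 <= K R r n n)].
Proof.
split; [|exact: K_cvg1 | exact: K_lower_bound].
move=> r n r0 n0; split; first exact: K_eq1.
by move=> A; exact: form_norm_gap.
Qed.
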